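(* Let $b\in\mathbb C$ and let $\mathcal I_{f_{II}^b}$ be the isotropy group of $f_{II}^b$ in $\mathrm{Aut}(A_1)\times\mathrm{Aut}(\mathfrak{sl}(2))$. Then $$\mathcal I_{f_{II}^b}=\{(\beta(w),w) : w\in B\}.$$ In particular, $\mathcal I_{f_{II}^b}$ is isomorphic to a Borel subgroup of $SO(3,\mathbb C)$.
   Context: The Weyl algebra $A_1$ is the complex associative unital algebra generated by $p,q$ with $pq-qp=1$, with Lie bracket $[a,b]=ab-ba$. $A_1^{\mathfrak{sl}(2)}$ is the set of injective Lie algebra homomorphisms $\mathfrak{sl}(2)=\mathfrak{sl}(2,\mathbb C)\to A_1$. The group $\mathrm{Aut}(A_1)\times\mathrm{Aut}(\mathfrak{sl}(2))$ acts on it by $(\alpha,w)\cdot f=\alpha\circ f\circ w^{-1}$, and the isotropy group of $f$ is its stabiliser $\{\gamma:\gamma\cdot f=f\}$. Let $e_+=\begin{pmatrix}0&1\\ 0&0\end{pmatrix}$, $e_-=\begin{pmatrix}0&0\\ 1&0\end{pmatrix}$, $e_0=\begin{pmatrix}1&0\\ 0&-1\end{pmatrix}$. The element $f_{II}^b\in A_1^{\mathfrak{sl}(2)}$ is defined by $f_{II}^b(e_+)=(b+pq)q$, $f_{II}^b(e_-)=-p$, $f_{II}^b(e_0)=2pq+b$. For $g\in SL(2,\mathbb C)$, $\mathrm{Ad}(g)(x)=gxg^{-1}$ on $\mathfrak{sl}(2)$. Let $\hat B=\left\{\begin{pmatrix}a_1&0\\ a_3&1/a_1\end{pmatrix}:a_1\in\mathbb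 C^*,a_3\in\mathbb C\right\}\subset SL(2,\mathbb C)$ and $B=\mathrm{Ad}(\hat B)\subset\mathrm{Aut}(\mathfrak{sl}(2))$. Let $\hat\beta:\hat B\to\mathrm{Aut}(A_1)$ be the group homomorphism given, for $g=\begin{pmatrix}a_1&0\\ a_3&1/a_1\end{pmatrix}$, by $\hat\beta(g)(p)=\frac1{a_1^2}p$, $\hat\beta(g)(q)=a_1^2\left(q-\frac{a_3}{a_1}\right)$. Since $\hat\beta(g)=\hat\beta(-g)$, $\hat\beta$ factors through $\mathrm{Ad}:\hat B\to B$; $\beta:B\to\mathrm{Aut}(A_1)$ is the resulting homomorphism, so $\beta(\mathrm{Ad}(g))=\hat\beta(g)$. *)

(* Defs.v *)
From HB Require Import structures.
From mathcomp Require Import all_boot all_order all_algebra ring.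
From mathcomp Require Import complex boolp classical_sets functions reals.
From mathcomp Require mpoly.

Set Implicit Arguments.
Unset Strict Implicit.
Unset Printing Implicit Defensive.

Import Order.TTheory GRing.Theory Num.Theory.
Local Open Scope classical_set_scope.
Local Open Scope ring_scope.
Local Open Scope quotient_scope.

(* The Weyl algebra A_1 = K<p,q>/(pq - qp - 1): expressions in p, q and the
   scalars, modulo the least congruence [weq] containing the axioms of unital
   associative K-algebras and the relation pq = qp + 1. *)

Inductive wexpr (K : Type) :=
  | WP | WQ | WC of K | WAdd of wexpr K & wexpr K | WMul of wexpr K & wexpr K.
Arguments WP {K}.
Arguments WQ {K}.

HB.instance Definition _ (K : Type) := gen_eqMixin (wexpr K).
HB.instance Definition _ (K : Type) := gen_choiceMixin (wexpr K).

Inductive weq (K : fieldType) : wexpr K -> wexpr K -> Prop :=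
  | weq_refl x : weq x x
  | weq_sym x y : weq x y -> weq y x
  | weq_trans x y z : weq x y -> weq y z -> weq x z
  | weq_add x x' y y' : weq x x' -> weq y y' -> weq (WAdd x y) (WAdd x' y')
  | weq_mul x x' y y' : weq x x' -> weq y y' -> weq (WMul x y) (WMul x' y')
  | weq_addA x y z : weq (WAdd x (WAdd y z)) (WAdd (WAdd x y) z)
  | weq_addC x y : weq (WAdd x y) (WAdd y x)
  | weq_add0 x : weq (WAdd (WC 0) x) x
  | weq_addN x : weq (WAdd (WMul (WC (-1)) x) x) (WC 0)
  | weq_mulA x y z : weq (WMul x (WMul y z)) (WMul (WMul x y) z)
  | weq_mul1l x : weq (WMul (WC 1) x) x
  | weq_mul1r x : weq (WMul x (WC 1)) x
  | weq_mulDl x y z : weq (WMul (WAdd x y) z) (WAdd (WMul x z) (WMul y z))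
  | weq_mulDr x y z : weq (WMul x (WAdd y z)) (WAdd (WMul x y) (WMul x z))
  | weq_CD a b : weq (WC (a + b)) (WAdd (WC a) (WC b))
  | weq_CM a b : weq (WC (a * b)) (WMul (WC a) (WC b))
  | weq_central a x : weq (WMul (WC a) x) (WMul x (WC a))
  | weq_pq : weq (WMul WP WQ) (WAdd (WMul WQ WP) (WC 1)).

(* The action of A_1 on K[X] with p = d/dX and q = X, used to separate
   elements of A_1. *)
Section PolyAction.
Variable K : fieldType.

Fixpoint wact (x : wexpr K) (v : {poly K}) : {poly K} :=
  match x with
  | WP => v^`()
  | WQ => 'X * v
  | WC c => c *: v
  | WAdd x y => wact x v + wact y v
  | WMul x y => wact x (wact y v)
  end.

Lemma wactD x u v : wact x (u + v) = wact x u + wact x v.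
Proof.
elim: x u v => [||c|x IHx y IHy|x IHx y IHy] u v /=.
- exact: derivD.
- exact: mulrDr.
- exact: scalerDr.
- by rewrite IHx IHy addrACA.
- by rewrite IHy IHx.
Qed.

Lemma wactZ x a v : wact x (a *: v) = a *: wact x v.
Proof.
elim: x v => [||c|x IHx y IHy|x IHx y IHy] v /=.
- exact: derivZ.
- by rewrite scalerAr.
- by rewrite !scalerA mulrC.
- by rewrite IHx IHy scalerDr.
- by rewrite IHy IHx.
Qed.

Lemma wact_weq x y : weq x y -> forall v, wact x v = wact y v.
Proof.
elim=> //=.
- by move=> x1 x2 x3 _ IH1 _ IH2 v; rewrite IH1.
- by move=> x1 x2 y1 y2 _ IH1 _ IH2 v; rewrite IH1 IH2.
- by move=> x1 x2 y1 y2 _ IH1 _ IH2 v; rewrite IH1 IH2.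
- by move=> *; rewrite addrA.
- by move=> *; rewrite addrC.
- by move=> *; rewrite scale0r add0r.
- by move=> *; rewrite scaleN1r addNr scale0r.
- by move=> *; rewrite scale1r.
- by move=> *; rewrite scale1r.
- by move=> *; rewrite wactD.
- by move=> *; rewrite scalerDl.
- by move=> *; rewrite scalerA.
- by move=> *; rewrite wactZ.
- by move=> v; rewrite derivM derivX mul1r scale1r addrC.
Qed.

End PolyAction.

Section Weyl.
Variable K : fieldType.

Definition weqb : rel (wexpr K) := fun x y => `[< weq x y >].

Lemma weqb_equiv : equiv_class_of weqb.
Proof.
split=> [x|x y|y x z].
- by apply/asboolP; exact: weq_refl.
- by apply/asboolP/asboolP; exact: weq_sym.
- by move=> /asboolP xy /asboolP yz; apply/asboolP; exact: weq_trans xy yz.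
Qed.

Canonical weqb_equivRel := EquivRelPack weqb_equiv.

Definition weyl : Type := {eq_quot weqb}.
HB.instance Definition _ := Choice.on weyl.

Definition wcl (x : wexpr K) : weyl := \pi_({eq_quot weqb}) x.

Lemma wclP x y : wcl x = wcl y <-> weq x y.
Proof. by split=> [/eqmodP/asboolP|xy]; [|apply/eqmodP/asboolP]. Qed.

Definition wrep (u : weyl) : wexpr K := repr (u : {eq_quot weqb}).

Lemma wrepK u : wcl (wrep u) = u. Proof. exact: reprK. Qed.

Lemma wclW (P : weyl -> Prop) : (forall x, P (wcl x)) -> forall u, P u.
Proof. by move=> H u; rewrite -(wrepK u). Qed.

Lemma wrep_cl x : weq (wrep (wcl x)) x.
Proof. by apply/wclP; rewrite wrepK. Qed.

Definition weyl_add (u v : weyl) := wcl (WAdd (wrep u) (wrep v)).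
Definition weyl_mul (u v : weyl) := wcl (WMul (wrep u) (wrep v)).
Definition weyl_opp (u : weyl) := wcl (WMul (WC (-1)) (wrep u)).
Definition weyl_scale (c : K) (u : weyl) := wcl (WMul (WC c) (wrep u)).

Lemma weyl_addE x y : weyl_add (wcl x) (wcl y) = wcl (WAdd x y).
Proof. by apply/wclP; apply: weq_add; exact: wrep_cl. Qed.
Lemma weyl_mulE x y : weyl_mul (wcl x) (wcl y) = wcl (WMul x y).
Proof. by apply/wclP; apply: weq_mul; exact: wrep_cl. Qed.
Lemma weyl_oppE x : weyl_opp (wcl x) = wcl (WMul (WC (-1)) x).
Proof. by apply/wclP; apply: weq_mul; [exact: weq_refl|exact: wrep_cl]. Qed.
Lemma weyl_scaleE c x : weyl_scale c (wcl x) = wcl (WMul (WC c) x).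
Proof. by apply/wclP; apply: weq_mul; [exact: weq_refl|exact: wrep_cl]. Qed.

Lemma weyl_addA : associative weyl_add.
Proof.
by elim/wclW=> x; elim/wclW=> y; elim/wclW=> z; rewrite !weyl_addE;
  apply/wclP; exact: weq_addA.
Qed.
Lemma weyl_addC : commutative weyl_add.
Proof.
by elim/wclW=> x; elim/wclW=> y; rewrite !weyl_addE; apply/wclP; exact: weq_addC.
Qed.
Lemma weyl_add0 : left_id (wcl (WC 0)) weyl_add.
Proof. by elim/wclW=> x; rewrite !weyl_addE; apply/wclP; exact: weq_add0. Qed.
Lemma weyl_addN : left_inverse (wcl (WC 0)) weyl_opp weyl_add.
Proof.
by elim/wclW=> x; rewrite weyl_oppE weyl_addE; apply/wclP; exact: weq_addN.
Qed.
Lemma weyl_mulA : associative weyl_mul.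
Proof.
by elim/wclW=> x; elim/wclW=> y; elim/wclW=> z; rewrite !weyl_mulE;
  apply/wclP; exact: weq_mulA.
Qed.
Lemma weyl_mul1l : left_id (wcl (WC 1)) weyl_mul.
Proof. by elim/wclW=> x; rewrite !weyl_mulE; apply/wclP; exact: weq_mul1l. Qed.
Lemma weyl_mul1r : right_id (wcl (WC 1)) weyl_mul.
Proof. by elim/wclW=> x; rewrite !weyl_mulE; apply/wclP; exact: weq_mul1r. Qed.
Lemma weyl_mulDl : left_distributive weyl_mul weyl_add.
Proof.
by elim/wclW=> x; elim/wclW=> y; elim/wclW=> z;
  rewrite !(weyl_addE, weyl_mulE); apply/wclP; exact: weq_mulDl.
Qed.
Lemma weyl_mulDr : right_distributive weyl_mul weyl_add.
Proof.
by elim/wclW=> x; elim/wclW=> y; elim/wclW=> z;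
  rewrite !(weyl_addE, weyl_mulE); apply/wclP; exact: weq_mulDr.
Qed.
Lemma weyl_1neq0 : wcl (WC 1) != wcl (WC 0).
Proof.
apply/eqP=> /wclP/wact_weq/(_ 1) /=; rewrite scale1r scale0r => /eqP.
by rewrite oner_eq0.
Qed.

HB.instance Definition _ :=
  GRing.isZmodule.Build weyl weyl_addA weyl_addC weyl_add0 weyl_addN.
HB.instance Definition _ := GRing.Zmodule_isNzRing.Build weyl
  weyl_mulA weyl_mul1l weyl_mul1r weyl_mulDl weyl_mulDr weyl_1neq0.

Lemma wclD x y : wcl (WAdd x y) = wcl x + wcl y.
Proof. by rewrite -weyl_addE. Qed.
Lemma wclM x y : wcl (WMul x y) = wcl x * wcl y.
Proof. by rewrite -weyl_mulE. Qed.
Lemma weyl_scale_mul c u : weyl_scale c u = wcl (WC c) * u.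
Proof. by elim/wclW: u => x; rewrite weyl_scaleE wclM. Qed.

Lemma weyl_scalerA a b u :
  weyl_scale a (weyl_scale b u) = weyl_scale (a * b) u.
Proof.
rewrite !weyl_scale_mul mulrA; congr (_ * _).
by rewrite -wclM; apply/wclP/weq_sym; exact: weq_CM.
Qed.
Lemma weyl_scale1r : left_id 1 weyl_scale.
Proof. by move=> u; rewrite weyl_scale_mul mul1r. Qed.
Lemma weyl_scalerDr : right_distributive weyl_scale +%R.
Proof. by move=> a u v; rewrite !weyl_scale_mul mulrDr. Qed.
Lemma weyl_scalerDl u : {morph weyl_scale^~ u : a b / a + b}.
Proof.
move=> a b; rewrite !weyl_scale_mul -mulrDl -wclD; congr (_ * _).
by apply/wclP; exact: weq_CD.
Qed.

HB.instance Definition _ := GRing.Zmodule_isLmodule.Build K weyl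
  weyl_scalerA weyl_scale1r weyl_scalerDr weyl_scalerDl.

Lemma weyl_scalerAl (a : K) (u v : weyl) : a *: (u * v) = (a *: u) * v.
Proof. by rewrite /GRing.scale /= !weyl_scale_mul mulrA. Qed.

HB.instance Definition _ :=
  GRing.Lmodule_isLalgebra.Build K weyl weyl_scalerAl.

Lemma weyl_central (a : K) u : wcl (WC a) * u = u * wcl (WC a).
Proof. by elim/wclW: u => x; rewrite -!wclM; apply/wclP; exact: weq_central. Qed.

Lemma weyl_scalerAr (a : K) (u v : weyl) : a *: (u * v) = u * (a *: v).
Proof. by rewrite /GRing.scale /= !weyl_scale_mul !mulrA weyl_central. Qed.

HB.instance Definition _ :=
  GRing.Lalgebra_isAlgebra.Build K weyl weyl_scalerAr.

Definition wp : weyl := wcl WP.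
Definition wq : weyl := wcl WQ.

Lemma wclC c : wcl (WC c) = c%:A.
Proof. by rewrite /GRing.scale /= weyl_scale_mul mulr1. Qed.

Lemma wclZ c x : wcl (WMul (WC c) x) = c *: wcl x.
Proof. by rewrite wclM wclC mulr_algl. Qed.

Lemma weyl_rel : wp * wq - wq * wp = 1.
Proof.
apply/eqP; rewrite subr_eq addrC -!wclM.
have -> : 1 = wcl (WC 1) :> weyl by [].
by rewrite -wclD; apply/eqP/wclP; exact: weq_pq.
Qed.

(* By the next lemmas, a pair (x, y) with xy - yx = 1 in an algebra B determines
   a unique algebra morphism weyl -> B with p |-> x and q |-> y. *)

Fixpoint weval (B : algType K) (x y : B) (e : wexpr K) : B :=
  match e with
  | WP => x
  | WQ => y
  | WC c => c%:A
  | WAdd e f => weval x y e + weval x y f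
  | WMul e f => weval x y e * weval x y f
  end.

Lemma weval_weq (B : algType K) (x y : B) (xy : x * y - y * x = 1) e f :
  weq e f -> weval x y e = weval x y f.
Proof.
elim=> //=.
- by move=> x1 x2 x3 _ IH1 _ IH2; rewrite IH1.
- by move=> x1 x2 y1 y2 _ IH1 _ IH2; rewrite IH1 IH2.
- by move=> x1 x2 y1 y2 _ IH1 _ IH2; rewrite IH1 IH2.
- by move=> *; rewrite addrA.
- by move=> *; rewrite addrC.
- by move=> *; rewrite scale0r add0r.
- by move=> *; rewrite scaleN1r mulN1r addNr scale0r.
- by move=> *; rewrite mulrA.
- by move=> *; rewrite scale1r mul1r.
- by move=> *; rewrite scale1r mulr1.
- by move=> *; rewrite mulrDl.
- by move=> *; rewrite mulrDr.
- by move=> *; rewrite scalerDl.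
- by move=> *; rewrite -scalerAl mul1r scalerA.
- by move=> *; rewrite mulr_algl mulr_algr.
- by rewrite scale1r -xy addrC subrK.
Qed.

Definition weyl_lift (B : algType K) (x y : B) (u : weyl) : B :=
  weval x y (wrep u).

Section Lift.
Variables (B : algType K) (x y : B).
Hypothesis xy : x * y - y * x = 1.

Lemma weyl_lift_cl e : weyl_lift x y (wcl e) = weval x y e.
Proof. exact: (weval_weq xy (wrep_cl e)). Qed.

Lemma weyl_lift_linear : linear (weyl_lift x y).
Proof.
move=> a u v; elim/wclW: u => u; elim/wclW: v => v.
by rewrite -wclZ -wclD !weyl_lift_cl /= mulr_algl.
Qed.

Lemma weyl_lift_monoid : GRing.monoid_morphism (weyl_lift x y).
Proof.
split; first by rewrite -(scale1r 1) -wclC weyl_lift_cl /= scale1r.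
by elim/wclW=> u; elim/wclW=> v; rewrite -wclM !weyl_lift_cl.
Qed.

Lemma weyl_lift_p : weyl_lift x y wp = x. Proof. exact: weyl_lift_cl. Qed.
Lemma weyl_lift_q : weyl_lift x y wq = y. Proof. exact: weyl_lift_cl. Qed.

Lemma weyl_lift_uniq (f : weyl -> B) :
  linear f -> GRing.monoid_morphism f -> f wp = x -> f wq = y ->
  f =1 weyl_lift x y.
Proof.
move=> linf [f1 fM] fp fq.
have fZ := GRing.scalable_linear linf.
have fD u v : f (u + v) = f u + f v by rewrite -[u in LHS]scale1r linf scale1r.
elim/wclW=> e; rewrite weyl_lift_cl.
elim: e => //= [c|e IHe e' IHe'|e IHe e' IHe'].
- by rewrite wclC fZ /= f1.
- by rewrite wclD fD IHe IHe'.
- by rewrite wclM fM; congr (_ * _).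
Qed.

End Lift.

End Weyl.

(* Symmetric groups; automorphism groups are subgroups of these. *)

Record sym (T : Type) := Sym {
  sym_fun :> T -> T;
  sym_inv : T -> T;
  sym_funK : cancel sym_fun sym_inv;
  sym_invK : cancel sym_inv sym_fun }.

HB.instance Definition _ (T : Type) := gen_eqMixin (sym T).
HB.instance Definition _ (T : Type) := gen_choiceMixin (sym T).

Section Sym.
Variable T : Type.
Implicit Types f g h : sym T.

Lemma symP f g : f =1 g -> f = g.
Proof.
case: f g => [f f' fK f'K] [g g' gK g'K] /= /funext fg; subst g.
have ff' : f' = g' by apply/funext => x; rewrite -{1}(g'K x) fK.
by subst g'; congr Sym; exact: Prop_irrelevance.
Qed.

Definition sym_one : sym T := @Sym T id id (fun=> erefl) (fun=> erefl).
Definition sym_mul f g : sym T :=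
  Sym (can_comp (@sym_funK _ f) (@sym_funK _ g))
      (can_comp (@sym_invK _ g) (@sym_invK _ f)).
Definition sym_symm f : sym T := Sym (@sym_invK _ f) (@sym_funK _ f).

Lemma sym_mulA : associative sym_mul. Proof. by move=> f g h; exact: symP. Qed.
Lemma sym_mul1l : left_id sym_one sym_mul. Proof. by move=> f; exact: symP. Qed.
Lemma sym_mul1r : right_id sym_one sym_mul. Proof. by move=> f; exact: symP. Qed.
Lemma sym_mulV : left_inverse sym_one sym_symm sym_mul.
Proof. by move=> f; apply: symP => x; exact: sym_funK. Qed.
Lemma sym_mulVr : right_inverse sym_one sym_symm sym_mul.
Proof. by move=> f; apply: symP => x; exact: sym_invK. Qed.

HB.instance Definition _ := isGroup.Build (sym T)
  sym_mulA sym_mul1l sym_mul1r sym_mulV sym_mulVr.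

End Sym.

Section AlgAut.
Variables (K : fieldType) (A : algType K).

Definition algaut_pred : pred (sym A) :=
  fun f => `[< linear f /\ GRing.monoid_morphism f >].

Record algaut := AlgAut { algaut_val :> sym A; _ : algaut_pred algaut_val }.

HB.instance Definition _ := [isSub for algaut_val].
HB.instance Definition _ := [Choice of algaut by <:].

Lemma algaut_closed : group_closed algaut_pred.
Proof.
split; first by apply/asboolP; split.
move=> f g /asboolP[lf [f1 fM]] /asboolP[lg [g1 gM]]; apply/asboolP.
have gI : injective g := can_inj (@sym_funK _ g).
have gV u : g (sym_inv g u) = u by exact: sym_invK.
split=> [a u v|]; first rewrite -lf; last split=> [|u v].
- by congr (f _); apply: gI; rewrite lg !gV.
- by rewrite -[RHS]f1; congr (f _); apply: gI; rewrite g1 gV.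
- by rewrite -fM; congr (f _); apply: gI; rewrite gM !gV.
Qed.

HB.instance Definition _ :=
  SubChoice_isSubGroup.Build (sym A) algaut_pred algaut algaut_closed.

End AlgAut.

Definition lieb (A : pzRingType) (a b : A) : A := a * b - b * a.

Section Lieb.
Variables (K : fieldType) (A : algType K).
Implicit Types x y z : A.

Lemma liebDl x y z : lieb (x + y) z = lieb x z + lieb y z.
Proof. by rewrite /lieb mulrDl mulrDr opprD addrACA. Qed.
Lemma liebDr x y z : lieb z (x + y) = lieb z x + lieb z y.
Proof. by rewrite /lieb mulrDl mulrDr opprD addrACA. Qed.
Lemma liebZl a x y : lieb (a *: x) y = a *: lieb x y.
Proof. by rewrite /lieb -scalerAl -scalerAr -scalerBr. Qed.
Lemma liebZr a x y : lieb x (a *: y) = a *: lieb x y.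
Proof. by rewrite /lieb -scalerAl -scalerAr -scalerBr. Qed.
Lemma liebxx x : lieb x x = 0. Proof. exact: subrr. Qed.
Lemma liebC x y : lieb x y = - lieb y x. Proof. by rewrite /lieb opprB. Qed.

Lemma lieb3 (a1 a2 a3 b1 b2 b3 : K) x y z :
  lieb (a1 *: x + a2 *: y + a3 *: z) (b1 *: x + b2 *: y + b3 *: z) =
  (a1 * b2 - a2 * b1) *: lieb x y + (a1 * b3 - a3 * b1) *: lieb x z +
  (a2 * b3 - a3 * b2) *: lieb y z.
Proof.
rewrite !(liebDl, liebDr, liebZl, liebZr) !liebxx !scaler0 !addr0 !add0r.
rewrite [lieb y x]liebC [lieb z x]liebC [lieb z y]liebC !scalerN !scalerA.
by rewrite [LHS](AC ((2*2)*2) ((1*3)*(2*5)*(4*6))) /= -!scalerBl.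
Qed.

End Lieb.

(* sl(2,K): traceless 2 x 2 matrices with the commutator bracket. *)
Section Sl2.
Variable K : fieldType.

Definition sl2_pred : pred 'M[K]_2 := fun x => \tr x == 0.

Record sl2 := Sl2 { sl2_val :> 'M[K]_2; _ : sl2_pred sl2_val }.

HB.instance Definition _ := [isSub for sl2_val].
HB.instance Definition _ := [Choice of sl2 by <:].

Lemma sl2_closed : submod_closed sl2_pred.
Proof.
split=> [|a x y]; rewrite !unfold_in /sl2_pred ?linear0 //.
by move=> /eqP tx /eqP ty; rewrite linearP /= tx ty mulr0 addr0.
Qed.

HB.instance Definition _ :=
  GRing.SubChoice_isSubLmodule.Build K 'M[K]_2 sl2_pred sl2 sl2_closed.

Lemma sl2_brk_subproof (x y : sl2) : sl2_pred (lieb (x : 'M_2) y).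
Proof. by rewrite /sl2_pred linearB /= mxtrace_mulC subrr. Qed.

Definition sl2_brk (x y : sl2) : sl2 := Sl2 (sl2_brk_subproof x y).

Definition mx22 (a b c d : K) : 'M[K]_2 :=
  \matrix_(i, j) if i == 0 then (if j == 0 then a else b)
                 else (if j == 0 then c else d).

Lemma mx22P (M N : 'M[K]_2) :
  M 0 0 = N 0 0 -> M 0 1 = N 0 1 -> M 1 0 = N 1 0 -> M 1 1 = N 1 1 -> M = N.
Proof.
move=> e00 e01 e10 e11; apply/matrixP => i j.
have [-> | ->] : i = 0 \/ i = 1.
- by case: i => [[|[|//]]] ?; [left | right]; apply: val_inj.
- by have [-> | ->] : j = 0 \/ j = 1
    by case: j => [[|[|//]]] ?; [left | right]; apply: val_inj.
- by have [-> | ->] : j = 0 \/ j = 1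
    by case: j => [[|[|//]]] ?; [left | right]; apply: val_inj.
Qed.

Lemma tr22 (x : 'M[K]_2) : \tr x = x 0 0 + x 1 1.
Proof. by rewrite /mxtrace big_ord_recl big_ord1; congr (_ + x _ _); exact: val_inj. Qed.

Lemma mul22 (x y : 'M[K]_2) i j : (x *m y) i j = x i 0 * y 0 j + x i 1 * y 1 j.
Proof.
by rewrite mxE big_ord_recl big_ord1; congr (_ + x _ _ * y _ _); exact: val_inj.
Qed.

Lemma sl2_11 (x : sl2) : x 1 1 = - x 0 0.
Proof. by apply/eqP; rewrite -addr_eq0 addrC -tr22; case: x. Qed.

Lemma e_plus_subproof : sl2_pred (mx22 0 1 0 0).
Proof. by rewrite /sl2_pred tr22 !mxE addr0. Qed.
Lemma e_minus_subproof : sl2_pred (mx22 0 0 1 0).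
Proof. by rewrite /sl2_pred tr22 !mxE addr0. Qed.
Lemma e_zero_subproof : sl2_pred (mx22 1 0 0 (-1)).
Proof. by rewrite /sl2_pred tr22 !mxE subrr. Qed.

Definition e_plus : sl2 := Sl2 e_plus_subproof.
Definition e_minus : sl2 := Sl2 e_minus_subproof.
Definition e_zero : sl2 := Sl2 e_zero_subproof.

Lemma sl2_decomp (x : sl2) :
  x = x 0 1 *: e_plus + x 1 0 *: e_minus + x 0 0 *: e_zero.
Proof.
apply: val_inj; rewrite /=; apply: mx22P; rewrite !mxE /=;
  by rewrite ?(mulr0, mulr1, addr0, add0r) // sl2_11 mulrN1.
Qed.

Definition lieaut_pred : pred (sym sl2) := fun w =>
  `[< linear w /\ forall x y, w (sl2_brk x y) = sl2_brk (w x) (w y) >].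

Record lieaut := LieAut { lieaut_val :> sym sl2; _ : lieaut_pred lieaut_val }.

HB.instance Definition _ := [isSub for lieaut_val].
HB.instance Definition _ := [Choice of lieaut by <:].

Lemma lieaut_closed : group_closed lieaut_pred.
Proof.
split; first by apply/asboolP; split.
move=> f g /asboolP[lf fM] /asboolP[lg gM]; apply/asboolP.
have gI : injective g := can_inj (@sym_funK _ g).
have gV u : g (sym_inv g u) = u by exact: sym_invK.
split=> [a u v|u v]; first rewrite -lf; last rewrite -fM.
- by congr (f _); apply: gI; rewrite lg !gV.
- by congr (f _); apply: gI; rewrite gM !gV.
Qed.

HB.instance Definition _ :=
  SubChoice_isSubGroup.Build (sym sl2) lieaut_pred lieaut lieaut_closed.

Definition SL2 := {g : 'M[K]_2 | \det g == 1}.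

Lemma SL2_unit (g : SL2) : val g \in unitmx.
Proof. by rewrite unitmxE (eqP (valP g)) unitr1. Qed.

Lemma conj_sl2_subproof (g : 'M[K]_2) (gU : g \in unitmx) (x : sl2) :
  sl2_pred (g *m x *m invmx g).
Proof. by rewrite /sl2_pred mxtrace_mulC mulmxA mulVmx // mul1mx; case: x. Qed.

Definition conj_sl2 g gU (x : sl2) : sl2 := Sl2 (@conj_sl2_subproof g gU x).

Lemma conj_sl2K g (gU : g \in unitmx) (gVU : invmx g \in unitmx) :
  cancel (conj_sl2 gU) (conj_sl2 gVU).
Proof.
move=> x; apply: val_inj => /=.
by rewrite invmxK !mulmxA mulVmx // mul1mx -mulmxA mulVmx // mulmx1.
Qed.

Lemma conj_sl2VK g (gU : g \in unitmx) (gVU : invmx g \in unitmx) :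
  cancel (conj_sl2 gVU) (conj_sl2 gU).
Proof.
move=> x; apply: val_inj => /=.
by rewrite invmxK !mulmxA mulmxV // mul1mx -mulmxA mulmxV // mulmx1.
Qed.

Definition SL2V_unit (g : SL2) : invmx (val g) \in unitmx :=
  etrans (unitmx_inv _) (SL2_unit g).

Definition Ad_sym (g : SL2) : sym sl2 :=
  Sym (conj_sl2K (SL2_unit g) (SL2V_unit g))
      (conj_sl2VK (SL2_unit g) (SL2V_unit g)).

Lemma Ad_subproof (g : SL2) : lieaut_pred (Ad_sym g).
Proof.
apply/asboolP; split=> [a x y|x y]; apply: val_inj => /=.
  by rewrite mulmxDr mulmxDl -scalemxAr -scalemxAl.
rewrite /lieb mulmxBr mulmxBl; congr (_ - _).
- rewrite -!mulmxE !mulmxA -[_ *m invmx _ *m val g]mulmxA.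
  by rewrite mulVmx ?SL2_unit // mulmx1.
- rewrite -!mulmxE !mulmxA -[_ *m invmx _ *m val g]mulmxA.
  by rewrite mulVmx ?SL2_unit // mulmx1.
Qed.

Definition Ad (g : SL2) : lieaut := LieAut (Ad_subproof g).

Definition Bhat : set SL2 :=
  [set g | exists a1 a3, a1 != 0 /\ val g = mx22 a1 0 a3 a1^-1].

Definition Bsl2 : set lieaut := Ad @` Bhat.

Lemma Bhat00_neq0 (g : Bhat) : val (val g) 0 0 != 0.
Proof.
by have [a1 [a3 [a1_neq0 ->]]] := set_mem (valP g); rewrite mxE.
Qed.

End Sl2.

Arguments Bhat K : clear implicits.
Arguments Bsl2 K : clear implicits.

Section Beta.
Variable K : fieldType.
Local Notation p := (wp K).
Local Notation q := (wq K).

Lemma affine_rel (s t : K) (ss : s * t = 1) (c : K) :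
  (s *: p) * (t *: (q - c%:A)) - (t *: (q - c%:A)) * (s *: p) = 1.
Proof.
rewrite -!scalerAl -!scalerAr !scalerA [t * s]mulrC -scalerBr ss scale1r.
by rewrite mulrBr mulrBl mulr_algl mulr_algr opprB addrA subrK weyl_rel.
Qed.

Definition affine_map (s t c : K) : weyl K -> weyl K :=
  weyl_lift (s *: p) (t *: (q - c%:A)).

Lemma affine_mapK (s t c : K) : s * t = 1 ->
  cancel (affine_map s t c) (affine_map t s (- c * t)).
Proof.
move=> st; have ts : t * s = 1 by rewrite mulrC.
set f := affine_map s t c; set g := affine_map t s _.
have rf := affine_rel st c; have rg := affine_rel ts (- c * t).
have lf : linear f := weyl_lift_linear rf.
have lg : linear g := weyl_lift_linear rg.
have [f1 fM] : GRing.monoid_morphism f := weyl_lift_monoid rf.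
have [g1 gM] : GRing.monoid_morphism g := weyl_lift_monoid rg.
have gZ := GRing.scalable_linear lg; have gB := GRing.zmod_morphism_linear lg.
have gf : g \o f =1 weyl_lift p q.
  apply: weyl_lift_uniq.
  - exact: weyl_rel.
  - by move=> a u v /=; rewrite lf lg.
  - by split=> [|u v] /=; rewrite ?f1 ?g1 // fM gM.
  - rewrite /= [f p](weyl_lift_p rf) gZ /=.
    by rewrite [g p](weyl_lift_p rg) scalerA st scale1r.
  - rewrite /= [f q](weyl_lift_q rf) gZ gB gZ /=.
    rewrite [g q](weyl_lift_q rg) g1 !scalerBr !scalerA ts scale1r mul1r.
    by rewrite mulNr scaleNr opprK [c * t]mulrC addrK.
move=> u; rewrite -[RHS]/(id u) -/(g (f u)).
rewrite -[LHS]/((g \o f) u) gf; symmetry.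
by apply: (@weyl_lift_uniq K (weyl K) p q (weyl_rel K) id).
Qed.

Lemma affine_mapVK (s t c : K) : s * t = 1 ->
  cancel (affine_map t s (- c * t)) (affine_map s t c).
Proof.
move=> st; have ts : t * s = 1 by rewrite mulrC.
have := @affine_mapK t s (- c * t) ts.
by rewrite mulNr opprK -mulrA ts mulr1.
Qed.

Definition affine_sym (s t c : K) (st : s * t = 1) : sym (weyl K) :=
  Sym (affine_mapK c st) (affine_mapVK c st).

Lemma affine_aut_subproof (s t c : K) (st : s * t = 1) :
  algaut_pred (affine_sym c st).
Proof.
apply/asboolP; split.
- exact: weyl_lift_linear (affine_rel st c).
- exact: weyl_lift_monoid (affine_rel st c).
Qed.

Definition affine_aut (s t c : K) (st : s * t = 1) : algaut (weyl K) :=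
  AlgAut (affine_aut_subproof c st).

Lemma betahat_subproof (g : Bhat K) :
  (val (val g) 0 0 ^+ 2)^-1 * val (val g) 0 0 ^+ 2 = 1.
Proof. by rewrite mulVf // expf_neq0 // Bhat00_neq0. Qed.

(* p |-> a1^-2 p and q |-> a1^2 (q - a3 / a1), where a1 and a3 are the entries
   of the first column of g. *)
Definition betahat (g : Bhat K) : algaut (weyl K) :=
  affine_aut (val (val g) 1 0 / val (val g) 0 0) (betahat_subproof g).

Lemma betahat_p (g : Bhat K) :
  betahat g p = (val (val g) 0 0 ^+ 2)^-1 *: p.
Proof. exact: weyl_lift_p (affine_rel (betahat_subproof g) _). Qed.

Lemma betahat_q (g : Bhat K) : betahat g q =
  val (val g) 0 0 ^+ 2 *: (q - (val (val g) 1 0 / val (val g) 0 0)%:A).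
Proof. exact: weyl_lift_q (affine_rel (betahat_subproof g) _). Qed.

Lemma algaut_ext (f g : algaut (weyl K)) : f p = g p -> f q = g q -> f = g.
Proof.
case: f => f Pf; case: g => g Pg /= fp fq; apply: val_inj => /=; apply: symP.
move: Pf Pg => /asboolP[lf mf] /asboolP[lg mg] u.
have rf : f p * f q - f q * f p = 1.
  have [f1 fM] := mf.
  by rewrite -!fM -f1 -(weyl_rel K) (GRing.zmod_morphism_linear lf).
rewrite (weyl_lift_uniq rf lf mf erefl erefl).
by rewrite (weyl_lift_uniq rf lg mg).
Qed.

Definition Bhat_of (w : Bsl2 K) : Bhat K :=
  sval (cid (let: ex_intro2 g Bg e := set_mem (valP w) in
             ex_intro (fun g' : Bhat K => Ad (val g') = val w)
               (exist _ g (mem_set Bg)) e)).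

Lemma Bhat_ofP (w : Bsl2 K) : Ad (val (Bhat_of w)) = val w.
Proof. by rewrite /Bhat_of; case: cid. Qed.

(* The value does not depend on the chosen preimage [Bhat_of w]: see [beta_Ad]. *)
Definition beta (w : Bsl2 K) : algaut (weyl K) := betahat (Bhat_of w).

Lemma Ad_e_plus (g : Bhat K) : let M := val (val g) in
  (Ad (val g) (e_plus K) 0 1 = M 0 0 ^+ 2) *
  (Ad (val g) (e_plus K) 0 0 = - (M 0 0 * M 1 0)).
Proof.
have [a [c [a_neq0 gE]]] := set_mem (valP g).
have Vg : invmx (val (val g)) = mx22 a^-1 0 (- c) a.
  rewrite -[RHS](mulKmx (SL2_unit (val g))) gE.
  suff -> : mx22 a 0 c a^-1 *m mx22 a^-1 0 (- c) a = 1%:M by rewrite mulmx1.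
  apply: mx22P; rewrite mul22 !mxE /= ?(mul0r, mulr0, addr0, add0r) ?mulfV //.
  - by rewrite [a^-1 * _]mulrC mulNr subrr.
  - by rewrite mulVf.
rewrite /= !mul22 -!/(val (val g)) Vg gE !mxE /=.
rewrite !(mul0r, mulr0, addr0, add0r, mulr1).
by rewrite mulrN expr2.
Qed.

Lemma betahat_Ad (g h : Bhat K) :
  Ad (val g) = Ad (val h) -> betahat g = betahat h.
Proof.
move=> gh; have [g1 g0] := Ad_e_plus g; have [h1 h0] := Ad_e_plus h.
have sq : val (val g) 0 0 ^+ 2 = val (val h) 0 0 ^+ 2 by rewrite -g1 -h1 gh.
have ac : val (val g) 0 0 * val (val g) 1 0 = val (val h) 0 0 * val (val h) 1 0.
  by apply: oppr_inj; rewrite -g0 -h0 gh.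
have divE (k : Bhat K) : val (val k) 1 0 / val (val k) 0 0 =
    val (val k) 0 0 * val (val k) 1 0 / val (val k) 0 0 ^+ 2.
  by rewrite expr2 -mulf_div divff ?mul1r // Bhat00_neq0.
by apply: algaut_ext; rewrite ?betahat_p ?betahat_q ?divE ?sq ?ac.
Qed.

Lemma beta_Ad (w : Bsl2 K) (g : Bhat K) :
  val w = Ad (val g) -> beta w = betahat g.
Proof. by move=> wg; apply: betahat_Ad; rewrite Bhat_ofP. Qed.

End Beta.

Section Realisations.
Variable K : fieldType.

Definition A1sl2 : set (sl2 K -> weyl K) :=
  [set f | [/\ linear f,
               forall x y, f (sl2_brk x y) = lieb (f x) (f y) &
               injective f]].

Definition act_fun (s : algaut (weyl K) * lieaut K) (f : sl2 K -> weyl K) :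
  sl2 K -> weyl K := s.1 \o f \o (s.2^-1)%g.

Arguments A1sl2 : clear implicits.

Lemma act_subproof s (f : A1sl2) : A1sl2 (act_fun s (val f)).
Proof.
case: s => a w; have [lf fB fI] := set_mem (valP f).
have : algaut_pred a by case: (a).
move=> /asboolP[la [a1 aM]].
rewrite /act_fun -[(a, w).2]/w -[(a, w).1]/a; move: (w^-1)%g => v.
have : lieaut_pred v by case: (v).
move=> /asboolP[lv vB]; split=> [c x y|x y|] /=.
- by rewrite lv lf la.
- by rewrite vB fB /lieb -!aM (GRing.zmod_morphism_linear la).
- apply: inj_comp (can_inj (@sym_funK _ a)) _.
  exact: inj_comp fI (can_inj (@sym_funK _ v)).
Qed.

Definition act s (f : A1sl2) : A1sl2 := 
  exist (fun h => h \in A1sl2) _ (mem_set (act_subproof s f)).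

Definition isotropy (f : A1sl2) : set (algaut (weyl K) * lieaut K) :=
  [set s | act s f = f].

End Realisations.

Arguments A1sl2 K : clear implicits.

Section FII.
Variables (K : numFieldType) (b : K).
Local Notation p := (wp K).
Local Notation q := (wq K).

Definition fII_fun (x : sl2 K) : weyl K :=
  x 0 1 *: ((b%:A + p * q) * q) + x 1 0 *: (- p) + x 0 0 *: ((p * q) *+ 2 + b%:A).

Lemma fII_e_plus : fII_fun (e_plus K) = (b%:A + p * q) * q.
Proof. by rewrite /fII_fun !mxE /= scale1r !scale0r !addr0. Qed.
Lemma fII_e_minus : fII_fun (e_minus K) = - p.
Proof. by rewrite /fII_fun !mxE /= scale1r !scale0r addr0 add0r. Qed.
Lemma fII_e_zero : fII_fun (e_zero K) = (p * q) *+ 2 + b%:A.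
Proof. by rewrite /fII_fun !mxE /= scale1r !scale0r !add0r. Qed.

Lemma fII_linear : linear fII_fun.
Proof.
move=> a x y; rewrite /fII_fun !mxE !scalerDl -!scalerA !scalerDr.
by rewrite [RHS]addrACA; congr (_ + _); rewrite addrACA.
Qed.

Lemma weyl_pq : p * q = q * p + 1.
Proof. by rewrite -(weyl_rel K) addrC subrK. Qed.

Lemma fII_PM : lieb (fII_fun (e_plus K)) (fII_fun (e_minus K)) =
  fII_fun (e_zero K).
Proof.
rewrite fII_e_plus fII_e_minus fII_e_zero /lieb mulrN mulNr opprK addrC.
have E : p * (p * q * q) - p * q * q * p = p * q *+ 2.
  rewrite -[p * q * q * p]mulrA -[p * q * (q * p)]mulrA -mulrBr -mulrnAr.
  congr (_ * _); apply/eqP; rewrite subr_eq weyl_pq mulrDl mul1r -mulrA weyl_pq.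
  by rewrite mulrDr mulr1 -addrA addrC.
rewrite mulrDl mulrDr mulrDl opprD addrACA E mulr_algl -scalerAr -scalerAl.
by rewrite -scalerBr weyl_rel addrC.
Qed.

Lemma fII_PZ : lieb (fII_fun (e_plus K)) (fII_fun (e_zero K)) =
  - (fII_fun (e_plus K) *+ 2).
Proof.
rewrite fII_e_plus fII_e_zero /lieb; set P := (b%:A + _) * q.
rewrite mulrDr mulrDl opprD addrACA mulr_algr mulr_algl subrr addr0.
rewrite mulrnAr mulrnAl -mulrnBl -mulNrn /P {P}; congr (_ *+ 2).
set A := b%:A + _; have comm : A * (p * q) = p * q * A.
  by rewrite /A mulrDl mulrDr mulr_algl mulr_algr.
rewrite -[A * q * _]mulrA [p * q * (A * q)]mulrA -comm -[A * (p * q) * q]mulrA.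
rewrite -mulrBr -[RHS]mulrN; congr (_ * _).
by rewrite mulrA -mulrBl -opprB weyl_rel mulN1r.
Qed.

Lemma fII_MZ : lieb (fII_fun (e_minus K)) (fII_fun (e_zero K)) =
  fII_fun (e_minus K) *+ 2.
Proof.
rewrite fII_e_minus fII_e_zero /lieb mulrDr mulrDl opprD addrACA.
rewrite mulr_algr mulr_algl subrr addr0 mulrnAr mulrnAl -mulrnBl.
congr (_ *+ 2).
by rewrite mulrN opprK mulNr addrC -mulrA -mulrBr -opprB weyl_rel mulrN mulr1.
Qed.

Lemma fII_brk x y : fII_fun (sl2_brk x y) = lieb (fII_fun x) (fII_fun y).
Proof.
have fE u : fII_fun u = u 0 1 *: fII_fun (e_plus K) +
    u 1 0 *: fII_fun (e_minus K) + u 0 0 *: fII_fun (e_zero K).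
  by rewrite fII_e_plus fII_e_minus fII_e_zero.
rewrite (fE (sl2_brk x y)) (fE x) (fE y).
rewrite lieb3 fII_PM fII_PZ fII_MZ -!scaler_nat !scalerN !scalerA -!scaleNr.
rewrite [RHS](AC 3 (2*3*1)) /=.
have brkE i j : sl2_brk x y i j =
    x i 0 * y 0 j + x i 1 * y 1 j - (y i 0 * x 0 j + y i 1 * x 1 j).
  by rewrite /= /lieb -!mulmxE mxE [X in _ + X]mxE !mul22.
by congr (_ *: _ + _ *: _ + _ *: _); rewrite brkE ?sl2_11; ring.
Qed.

Lemma fII_inj : injective fII_fun.
Proof.
have fB := GRing.zmod_morphism_linear fII_linear.
suff H x : fII_fun x = 0 -> x = 0.
  by move=> x y xy; apply/eqP; rewrite -subr_eq0; apply/eqP/H; rewrite fB xy subrr.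
pose E : wexpr K := WAdd (WAdd
  (WMul (WC (x 0 1)) (WMul (WAdd (WC b) (WMul WP WQ)) WQ))
  (WMul (WC (- x 1 0)) WP))
  (WMul (WC (x 0 0)) (WAdd (WMul (WC 2%:R) (WMul WP WQ)) (WC b))).
have -> : fII_fun x = wcl E.
  rewrite /E !(wclD, wclZ) !(wclM, wclD, wclC) /fII_fun.
  by rewrite scaleNr scalerN scaler_nat.
have -> : 0 = wcl (WC 0) :> weyl K by [].
move=> /wclP/wact_weq act0.
have c n k : (wact E 'X^n)`_k = 0 by rewrite act0 /= scale0r coef0.
have := (c 1 2, c 2 3, c 1 1, c 2 2, c 1 0)%N.
rewrite /= !(coefD, coefZ, coef_deriv, coefXM, coefXn, coefX) /=.
rewrite !(mulr0, mul0r, mulr0n, mul0rn, addr0, add0r, mulr1) => -[[[[c1 c2] c3] c4] c5].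
have x01 : x 0 1 = 0.
  have -> : x 0 1 = x 0 1 * (b + 1 *+ 4) - x 0 1 * (b + 1 *+ 3) by ring.
  by rewrite c1 c2 subrr.
have x00 : x 0 0 = 0.
  have /eqP : x 0 0 * 2 = 0.
    have -> : x 0 0 * 2 = x 0 0 * (2 * (1 *+ 3) + b) - x 0 0 * (2 * (1 *+ 2) + b).
      by ring.
    by rewrite c3 c4 subrr.
  by rewrite mulf_eq0 pnatr_eq0 orbF => /eqP.
have x10 : x 1 0 = 0 by apply/oppr_inj; rewrite c5 oppr0.
by apply: val_inj; apply: mx22P; rewrite ?sl2_11 ?x00 ?x01 ?x10 !mxE ?oppr0.
Qed.

Definition fII : A1sl2 K :=
  exist (fun f => f \in A1sl2 K) fII_fun (mem_set (And3 fII_linear fII_brk fII_inj)).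

End FII.

Definition sub_isog (G H : groupType) (A : set G) (B : set H) :=
  exists f : G -> H,
    set_bij A B f /\ {in A &, forall x y, f (x * y)%g = (f x * f y)%g}.

Section SO3.
Variable K : fieldType.

Record SO3 := SO3_of {
  SO3_val :> 'M[K]_3;
  _ : (SO3_val *m SO3_val^T == 1%:M) && (\det SO3_val == 1) }.

HB.instance Definition _ := [isSub for SO3_val].
HB.instance Definition _ := [Choice of SO3 by <:].

Lemma SO3V (g : SO3) : (g : 'M_3) *m g^T = 1%:M.
Proof. by case: g => g /= /andP[/eqP]. Qed.

Lemma SO3_det (g : SO3) : \det (g : 'M_3) = 1.
Proof. by case: g => g /= /andP[_ /eqP]. Qed.

Lemma SO3_one_subproof :
  (1%:M *m (1%:M : 'M[K]_3)^T == 1%:M) && (\det (1%:M : 'M[K]_3) == 1).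
Proof. by rewrite trmx1 mulmx1 det1 !eqxx. Qed.

Lemma SO3_mul_subproof (g h : SO3) :
  (g *m h *m (g *m h)^T == 1%:M) && (\det (g *m h) == 1).
Proof.
rewrite trmx_mul mulmxA -[g *m h *m _]mulmxA SO3V mulmx1 SO3V.
by rewrite det_mulmx !SO3_det mul1r !eqxx.
Qed.

Lemma SO3_inv_subproof (g : SO3) :
  (g^T *m g^T^T == 1%:M) && (\det g^T == 1).
Proof. by rewrite trmxK (mulmx1C (SO3V g)) det_tr SO3_det !eqxx. Qed.

Definition SO3_one : SO3 := SO3_of SO3_one_subproof.
Definition SO3_mul (g h : SO3) : SO3 := SO3_of (SO3_mul_subproof g h).
Definition SO3_inv (g : SO3) : SO3 := SO3_of (SO3_inv_subproof g).

Lemma SO3_mulA : associative SO3_mul.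
Proof. by move=> f g h; apply: val_inj; exact: mulmxA. Qed.
Lemma SO3_mul1l : left_id SO3_one SO3_mul.
Proof. by move=> f; apply: val_inj; exact: mul1mx. Qed.
Lemma SO3_mul1r : right_id SO3_one SO3_mul.
Proof. by move=> f; apply: val_inj; exact: mulmx1. Qed.
Lemma SO3_mulV : left_inverse SO3_one SO3_inv SO3_mul.
Proof. by move=> f; apply: val_inj; exact: mulmx1C (SO3V f). Qed.
Lemma SO3_mulVr : right_inverse SO3_one SO3_inv SO3_mul.
Proof. by move=> f; apply: val_inj; exact: SO3V f. Qed.

HB.instance Definition _ := isGroup.Build SO3
  SO3_mulA SO3_mul1l SO3_mul1r SO3_mulV SO3_mulVr.

(* Zero loci of families of polynomials in the 9 matrix entries. *)
Definition zariski_closed (Z : set SO3) :=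
  exists S : set (mpoly.mpoly (3 * 3) K),
    Z = [set g | forall P, S P ->
                   mpoly.meval (fun k => mxvec (g : 'M_3) 0 k) P = 0].

Definition zariski_connected (H : set SO3) :=
  forall Z1 Z2, zariski_closed Z1 -> zariski_closed Z2 ->
    H `<=` Z1 `|` Z2 -> H `&` Z1 `&` Z2 = set0 -> H `<=` Z1 \/ H `<=` Z2.

End SO3.

Section Solvable.
Variable G : groupType.

Definition is_subgroup (H : set G) := group_closed (mem H).

Definition derived_sub (H : set G) : set G :=
  smallest is_subgroup [set [~ x, y]%g | x in H & y in H].

Definition solvable_sub (H : set G) :=
  exists n, iter n derived_sub H = [set 1%g].

End Solvable.

(* Borel subgroups (for K algebraically closed): the maximal Zariski closed,
   connected, solvable subgroups. *)
Section Borel.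
Variable K : fieldType.

Definition closed_connected_solvable (H : set (SO3 K)) :=
  [/\ is_subgroup H, zariski_closed H, zariski_connected H & solvable_sub H].

Definition borel (H : set (SO3 K)) :=
  closed_connected_solvable H /\
  forall H', closed_connected_solvable H' -> H `<=` H' -> H' = H.

End Borel.

(* Main.v *)
Require Import Defs.
From mathcomp Require Import all_boot all_order all_algebra ring.
From mathcomp Require Import complex boolp classical_sets functions reals.
From mathcomp Require Import mpoly.

(** The element [(f, w)] fixes [fII b] exactly when [f \o fII b = fII b \o w].

    That every [(beta w, w)] does so is a computation on the basis of sl(2)
    ([betahat_fII]).  Conversely, let [(f, w)] be in the isotropy group.  The
    derivation [lieb p] of A_1 is locally nilpotent: this passes from the
    generators to products by the Leibniz rule.  Hence so is [lieb (f (- p))],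
    where [f (- p) = fII b (w e_-)].  For [x] in sl(2), however,
    [lieb (fII b x)] acts on the polynomials in [q] as the vector field
    [V d/dq] with [V = x_01 q^2 + 2 x_00 q - x_10], and this is locally nilpotent
    only if [V] is constant ([ad_nil_fII]).  So [w e_-] is a multiple of [e_-].
    The brackets then give [w e_0 = e_0 + 2 n e_-], and since [e_-] and [e_0]
    determine an automorphism of sl(2) ([lieaut_ext]), [w] is in [B].  Finally
    [w] determines [f]: it determines [f p] and [f (p * q) = f p * f q], and left
    multiplication by [p] is injective ([weyl_p_lreg]).

    The group [B] is identified with the stabiliser [line_stab] of an isotropic
    line in SO(3), by writing [w] in the basis [e_-], [e_0], [e_+] and passing to
    an orthonormal basis of the Killing form.  Both groups are the set of pairs
    [(s, n)] with [s] nonzero, where [s = a_1^2] and [n = a_3 / a_1].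
    The stabiliser is Zariski closed, as it is cut out by two linear equations;
    it is irreducible, hence connected, because any two of its points lie on a
    rational curve inside it ([line_stab_connected]); it is solvable because its
    commutators lie in the abelian unipotent subgroup [s = 1].  It is maximal
    among solvable subgroups: by the Bruhat decomposition, a larger subgroup
    contains an element exchanging two isotropic lines, hence the unipotent
    subgroups of both lines, and a group containing these two passes them on to
    its derived subgroup ([derived_unipotents]).  *)

Set Implicit Arguments.
Unset Strict Implicit.
Unset Printing Implicit Defensive.
Import Order.TTheory GRing.Theory Num.Theory.
Local Open Scope classical_set_scope.
Local Open Scope ring_scope.

(** * Locally nilpotent inner derivations of the Weyl algebra *)

Section LocallyNilpotent.
Variables (K : fieldType) (A : algType K) (a : A).
Implicit Types u v : A.

Lemma lieb_mulr u v : lieb a (u * v) = lieb a u * v + u * lieb a v.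
Proof. by rewrite /lieb mulrBl mulrBr !mulrA addrA subrK. Qed.

Lemma iter_liebD n u v :
  iter n (lieb a) (u + v) = iter n (lieb a) u + iter n (lieb a) v.
Proof. by elim: n => //= n ->; rewrite liebDr. Qed.

Lemma iter_lieb0 n : iter n (lieb a) 0 = 0.
Proof. by elim: n => //= n ->; rewrite /lieb mulr0 mul0r subrr. Qed.

Definition ad_nil u := exists n, iter n (lieb a) u = 0.

Lemma iter_lieb_addn m n u :
  iter n (lieb a) u = 0 -> iter (m + n) (lieb a) u = 0.
Proof. by rewrite iterD => ->; rewrite iter_lieb0. Qed.

Lemma ad_nilD u v : ad_nil u -> ad_nil v -> ad_nil (u + v).
Proof.
move=> [m um] [n vn]; exists (m + n)%N.
rewrite iter_liebD (iter_lieb_addn m vn) addr0 addnC.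
exact: iter_lieb_addn.
Qed.

(** By the Leibniz rule, each application of [lieb a] to a product uses up one
    unit of the nilpotency order of one of the two factors. *)
Lemma ad_nilM u v : ad_nil u -> ad_nil v -> ad_nil (u * v).
Proof.
move=> [m um] [n vn]; exists (m + n)%N.
have [N] := ubnP (m + n); elim: N => // N IH in m n u v um vn *.
case: m um => [/= ->|m um]; first by rewrite mul0r iter_lieb0.
case: n vn => [|n] vn; first by rewrite [v]vn mulr0 iter_lieb0.
rewrite addnS ltnS => ltN; rewrite iterSr lieb_mulr iter_liebD.
rewrite [X in X + _](_ : _ = 0) ?add0r.
  by apply: IH => //; rewrite -iterSr.
by rewrite addSnnS; apply: IH; rewrite -?iterSr // -addSnnS.
Qed.

Lemma ad_nilC (c : K) : ad_nil c%:A.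
Proof. by exists 1%N; rewrite /= /lieb mulr_algl mulr_algr subrr. Qed.

End LocallyNilpotent.

Section WeylNilpotent.
Variable K : numFieldType.
Local Notation p := (wp K).
Local Notation q := (wq K).
Implicit Types (u : weyl K) (h : {poly K}) (x : sl2 K).

Lemma ad_nil_weyl a : ad_nil a p -> ad_nil a q -> forall u, ad_nil a u.
Proof.
move=> ap aq; elim/wclW; elim=> // [c|e IHe f IHf|e IHe f IHf].
- by rewrite wclC; exact: ad_nilC.
- by rewrite wclD; exact: ad_nilD.
- by rewrite wclM; exact: ad_nilM.
Qed.

Lemma ad_p_nil u : ad_nil p u.
Proof.
apply: ad_nil_weyl u; first by exists 1%N; exact: liebxx.
exists 2%N; rewrite /= [lieb p q](weyl_rel K).
by rewrite /lieb mulr1 mul1r subrr.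
Qed.

Lemma ad_q_nil u : ad_nil q u.
Proof.
apply: ad_nil_weyl u; last by exists 1%N; exact: liebxx.
exists 2%N; rewrite /= [lieb q p]liebC [lieb p q](weyl_rel K).
by rewrite /lieb mulrN1 mulN1r subrr.
Qed.

(** Since [lieb q] is locally nilpotent and moves [p] to [-1], a solution of
    [p * u = 0] satisfies [p * (lieb q)^(n+1) u = (n+1) (lieb q)^n u]; so the
    last nonzero [(lieb q)^n u] cannot exist.  This gives the cancellation needed
    below without showing that A_1 is a domain. *)
Lemma weyl_p_lreg u : p * u = 0 -> u = 0.
Proof.
move=> pu; have pad n : p * iter n.+1 (lieb q) u = iter n (lieb q) u *+ n.+1.
  have lieb_p v : p * lieb q v = lieb q (p * v) + v.
    rewrite /lieb mulrBr !mulrA -[p * q](subrK (q * p)) weyl_rel.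
    by rewrite mulrDl mul1r -addrA addrC.
  elim: n => [|n IHn]; first by rewrite /= lieb_p pu /lieb mulr0 mul0r subrr add0r.
  by rewrite iterS lieb_p IHn -scaler_nat liebZr scaler_nat -iterS -mulrSr.
have [n] := ad_q_nil u; elim: n => // n IHn ad0; apply: IHn.
move: (pad n); rewrite ad0 mulr0 -scaler_nat => /esym/eqP.
by rewrite scaler_eq0 pnatr_eq0 => /eqP.
Qed.

Local Notation "h .[q]" := (horner_alg q h) (at level 2, format "h .[q]").

Lemma qpolyMXaddC h (c : K) : (h * 'X + c%:P).[q] = h.[q] * q + c%:A.
Proof. by rewrite rmorphD rmorphM /= horner_algX horner_algC. Qed.

Lemma qpolyC h : q * h.[q] = h.[q] * q.
Proof.
have : ('X * h).[q] = (h * 'X).[q] by rewrite mulrC.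
by rewrite !rmorphM /= horner_algX.
Qed.

(** [lieb p] is [d/dq] on the polynomials in [q]; in particular such a
    polynomial vanishes only if its coefficients do ([qpoly_eq0]). *)
Lemma lieb_p_qpoly h : lieb p h.[q] = (h^`()).[q].
Proof.
elim/poly_ind: h => [|h c IHh]; first by rewrite deriv0 rmorph0 /lieb mulr0 mul0r subrr.
rewrite qpolyMXaddC derivMXaddC rmorphD rmorphM /= horner_algX -IHh.
rewrite liebDr lieb_mulr [lieb p q](weyl_rel K) mulr1 /lieb.
by rewrite mulr_algl mulr_algr subrr addr0 addrC.
Qed.

Lemma size_derivE h : size h^`() = (size h).-1.
Proof.
have [->|h0] := eqVneq h 0; first by rewrite deriv0 size_poly0.
have [h1|h1] := leqP (size h) 1.
  by rewrite (size1_polyC h1) derivC size_poly0 size_polyC; case: (_ != _).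
apply: size_poly_eq.
have -> : ((size h).-1.-1.+1 = (size h).-1)%N by case: (size h) h1 => [|[]].
rewrite -mulr_natr mulf_neq0 ?pnatr_eq0 -?lead_coefE ?lead_coef_eq0 //.
by case: (size h) h1 => [|[]].
Qed.

Lemma qpoly_eq0 h : h.[q] = 0 -> h = 0.
Proof.
have [n] := ubnP (size h); elim: n => // n IHn in h * => lthn h0.
have dh0 : h^`() = 0.
  have [->|hn0] := eqVneq h 0; first exact: deriv0.
  apply: IHn; last by rewrite -lieb_p_qpoly h0 /lieb mulr0 mul0r subrr.
  exact: leq_trans (lt_size_deriv hn0) _.
have /size1_polyC hC : (size h <= 1)%N.
  by rewrite -subn_eq0 subn1 -size_derivE dh0 size_poly0.
move: h0; rewrite hC horner_algC => /eqP.
by rewrite scaler_eq0 oner_eq0 orbF => /eqP ->.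
Qed.

Variable b : K.

(** The realisation of sl(2) by quadratic vector fields on the line: [b] drops
    out because it only contributes operators commuting with [q]. *)
Lemma lieb_fII_qpoly x h : lieb (fII_fun b x) h.[q] =
  ((x 0 1 *: 'X^2 + (x 0 0 *+ 2) *: 'X - (x 1 0)%:P) * h^`()).[q].
Proof.
have brq : lieb q h.[q] = 0 by rewrite /lieb qpolyC subrr.
have brp : lieb p h.[q] = h^`().[q] := lieb_p_qpoly h.
have lMl (u v w : weyl K) : lieb (u * v) w = u * lieb v w + lieb u w * v.
  by rewrite /lieb mulrBr mulrBl !mulrA addrA subrK.
have brC c : lieb c%:A h.[q] = 0 by rewrite /lieb mulr_algl mulr_algr subrr.
rewrite /fII_fun !liebDl !liebZl !liebDl !lMl !liebDl !lMl brq brC !brp scaleN1r.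
rewrite !(mulr0, add0r, addr0).
rewrite -!mul_polyC expr2 rmorphM rmorphB rmorphD !rmorphM /= !horner_algC !horner_algX.
rewrite mulrBl mulrDl -!scalerAl !mul1r -[q * q * _]mulrA !qpolyC -mulr2n.
by rewrite -[_ *+ 2]scaler_nat scalerA mulr_natr scalerN addrAC mulrA qpolyC.
Qed.

(** If the coefficient [V] of the vector field has degree at least 1, then in
    characteristic 0 the operator [h |-> V * h'] never lowers the degree of a
    nonconstant polynomial to 0, so its iterates on ['X] do not vanish. *)
Lemma ad_nil_fII x : (forall u, ad_nil (fII_fun b x) u) ->
  x 0 0 = 0 /\ x 0 1 = 0.
Proof.
move=> /(_ q); set V : {poly K} := x 0 1 *: 'X^2 + (x 0 0 *+ 2) *: 'X - (x 1 0)%:P.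
have sizeV : (size V <= 1)%N -> x 0 0 = 0 /\ x 0 1 = 0.
  move=> /size1_polyC/polyP VC; split.
    have := VC 1%N; rewrite !(coefC, coefB, coefD, coefZ, coefX, coefXn) /=.
    rewrite mulr0 mulr1 subr0 add0r => /eqP.
    by rewrite -mulr_natr mulf_eq0 pnatr_eq0 orbF => /eqP.
  have := VC 2%N; rewrite !(coefC, coefB, coefD, coefZ, coefX, coefXn) /=.
  by rewrite mulr0 mulr1 subr0 addr0.
case=> n; have -> : q = 'X.[q] by rewrite horner_algX.
have [/sizeV //|V_gt1] := leqP (size V) 1.
pose D h := V * h^`().
have -> : iter n (lieb (fII_fun b x)) 'X.[q] = (iter n D 'X).[q].
  by elim: n => //= n ->; exact: lieb_fII_qpoly.
move=> /qpoly_eq0 h0; have : (1 < size (iter n D 'X))%N.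
  elim: n {h0} => [|n]; first by rewrite size_polyX.
  rewrite iterS /D; move: (iter n _ _) => h h_gt1.
  have Vn0 : V != 0 by rewrite -size_poly_gt0 ltnW.
  have h'_gt0 : (0 < size h^`())%N.
    by rewrite size_derivE; case: (size h) h_gt1 => [|[]].
  rewrite size_mul // -?size_poly_gt0 //.
  by rewrite -(subnKC V_gt1) -(prednK h'_gt0) addnS.
by rewrite h0 size_poly0.
Qed.

End WeylNilpotent.

(** * The isotropy group is the graph of [beta] *)

Section BorelParameters.
Variable K : fieldType.
Implicit Types (g : Bhat K) (x y : sl2 K) (w : lieaut K).
Local Notation e_plus := (e_plus K).
Local Notation e_minus := (e_minus K).
Local Notation e_zero := (e_zero K).

(** [bscale g] and [bshift g] are coordinates on the image of [g] under [Ad]: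
    they do not change when [g] is replaced by [- g]. *)
Definition bscale g : K := val (val g) 0 0 ^+ 2.
Definition bshift g : K := val (val g) 1 0 / val (val g) 0 0.

Lemma bscale_neq0 g : bscale g != 0.
Proof. by rewrite expf_neq0 // Bhat00_neq0. Qed.

Lemma Bhat_Ad g : [/\ Ad (val g) e_minus = (bscale g)^-1 *: e_minus,
  Ad (val g) e_zero = e_zero + (bshift g *+ 2) *: e_minus &
  Ad (val g) e_plus = bscale g *: e_plus - (bscale g * bshift g) *: e_zero
                      - (bscale g * bshift g ^+ 2) *: e_minus].
Proof.
have a0 := Bhat00_neq0 g; rewrite /bscale /bshift.
have [a [c [a_neq0 gE]]] := set_mem (valP g).
have Vg : invmx (val (val g)) = mx22 a^-1 0 (- c) a.
  rewrite -[RHS](mulKmx (SL2_unit (val g))) gE.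
  suff -> : mx22 a 0 c a^-1 *m mx22 a^-1 0 (- c) a = 1%:M by rewrite mulmx1.
  by apply: mx22P; rewrite mul22 !mxE /=; field.
by split; apply: val_inj; apply: mx22P; rewrite /= !mul22 -!/(val (val g)) Vg gE !mxE /=;
  field.
Qed.

Lemma lieaut_linear w : linear w.
Proof. by have /asboolP[] : lieaut_pred w by case: w. Qed.

Lemma lieaut_brk w x y : w (sl2_brk x y) = sl2_brk (w x) (w y).
Proof. by have /asboolP[_ ->] : lieaut_pred w by case: w. Qed.

Lemma algaut_linear (A : algType K) (f : algaut A) : linear f.
Proof. by have /asboolP[] : algaut_pred f by case: f. Qed.

Lemma algaut_monoid (A : algType K) (f : algaut A) : GRing.monoid_morphism f.
Proof. by have /asboolP[] : algaut_pred f by case: f. Qed.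

Lemma linear_comb3 (V W : lmodType K) (f : V -> W) a b c u v t : linear f ->
  f (a *: u + b *: v + c *: t) = a *: f u + b *: f v + c *: f t.
Proof.
move=> lf; have fZ := GRing.scalable_linear lf.
have fD (y z : V) : f (y + z) = f y + f z by rewrite -[y in LHS]scale1r lf scale1r.
by rewrite !fD !fZ.
Qed.

Lemma sl2_brkE x y i j : sl2_brk x y i j =
  x i 0 * y 0 j + x i 1 * y 1 j - (y i 0 * x 0 j + y i 1 * x 1 j).
Proof. by rewrite /= /lieb -!mulmxE mxE [X in _ + X]mxE !mul22. Qed.

Lemma sl2P x y : x 0 0 = y 0 0 -> x 0 1 = y 0 1 -> x 1 0 = y 1 0 -> x = y.
Proof. by move=> e1 e2 e3; apply: val_inj; apply: mx22P; rewrite ?sl2_11 ?e1. Qed.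

Lemma brk_pm : sl2_brk e_plus e_minus = e_zero.
Proof. by apply: sl2P; rewrite sl2_brkE !mxE /=; ring. Qed.

Lemma brk_pz : sl2_brk e_plus e_zero = (- 2%:R) *: e_plus.
Proof. by apply: sl2P; rewrite sl2_brkE !mxE /=; ring. Qed.

Lemma brk_mz : sl2_brk e_minus e_zero = 2%:R *: e_minus.
Proof. by apply: sl2P; rewrite sl2_brkE !mxE /=; ring. Qed.

(** The vector [e_+] is the only solution [z] of [[z, e_-] = e_0] and
    [[z, e_0] = - 2 z]; this is applied to the preimage under [w] of [w' e_+]. *)
Lemma lieaut_ext w w' : 2%:R != 0 :> K -> w e_minus = w' e_minus ->
  w e_zero = w' e_zero -> w = w'.
Proof.
move=> two_neq0 wm wz; have lw := lieaut_linear w; have lw' := lieaut_linear w'.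
have wI : injective w := can_inj (@sym_funK _ w).
have [z wzE] : exists z, w z = w' e_plus.
  by exists (sym_inv w (w' e_plus)); exact: sym_invK.
have zm : sl2_brk z e_minus = e_zero.
  by apply: wI; rewrite lieaut_brk wzE wm -lieaut_brk brk_pm wz.
have zz : sl2_brk z e_zero = (- 2%:R) *: z.
  apply: wI; rewrite lieaut_brk wzE wz -lieaut_brk brk_pz.
  by rewrite (GRing.scalable_linear lw) (GRing.scalable_linear lw') wzE.
have zE : z = e_plus.
  have /(congr1 (fun y : sl2 K => y 0 0)) := zm.
  have /(congr1 (fun y : sl2 K => y 1 0)) := zm.
  have /(congr1 (fun y : sl2 K => y 1 0)) := zz.
  rewrite !sl2_brkE !mxE /= !sl2_11 => h1 h2 h3.
  apply: sl2P; rewrite !mxE /=.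
  - by apply: (mulfI two_neq0); apply: oppr_inj; rewrite mulr0 oppr0 -[RHS]h2; ring.
  - by rewrite -[RHS]h3; ring.
  - apply: (mulfI two_neq0); apply: (mulfI two_neq0).
    by rewrite !mulr0 -(subrr (- 2%:R * z 1 0)) -{1}h1; ring.
have wp : w e_plus = w' e_plus by rewrite -wzE zE.
apply: val_inj; apply: symP => x.
by rewrite [x]sl2_decomp !linear_comb3 // wp wm wz.
Qed.

Lemma Bhat_of_params (s n a : K) : a != 0 -> a ^+ 2 = s ->
  exists g, bscale g = s /\ bshift g = n.
Proof.
move=> a0 sa; have dg : \det (mx22 a 0 (n * a) a^-1) == 1.
  rewrite det_trig ?big_ord_recl ?big_ord0 ?mxE /= ?mulr1 ?mulfV //.
  by apply/is_trig_mxP => -[[|[|//]] ?] [[|[|//]] ?]; rewrite !mxE.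
pose g : SL2 K := exist (fun M : 'M[K]_2 => \det M == 1) _ dg.
have Bg : Bhat K g by exists a, (n * a).
exists (exist (fun h => h \in Bhat K) g (mem_set Bg)).
by rewrite /bscale /bshift /= !mxE /= -sa mulfK.
Qed.

End BorelParameters.

Section Intertwining.
Variables (K : numFieldType) (b : K).
Local Notation p := (wp K).
Local Notation q := (wq K).
Implicit Types (g : Bhat K) (x y : sl2 K) (w : lieaut K).

Lemma fII_linear_comb (a1 a2 a3 : K) : forall x y z,
  fII_fun b (a1 *: x + a2 *: y + a3 *: z) =
    a1 *: fII_fun b x + a2 *: fII_fun b y + a3 *: fII_fun b z.
Proof. by move=> x y z; exact: linear_comb3 (fII_linear b). Qed.

(** With [s = bscale g] and [n = bshift g], [betahat g] maps [p * q] to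
    [p * q - n p]; expanding the three images of the basis gives the matrix of
    [Ad g]. *)
Lemma betahat_fII g x : betahat g (fII_fun b x) = fII_fun b (Ad (val g) x).
Proof.
have [la [a1 aM]] := (algaut_linear (betahat g), algaut_monoid (betahat g)).
have decomp := linear_comb3 (x 0 1) (x 1 0) (x 0 0) (e_plus K) (e_minus K) (e_zero K).
suff [Ep Em Ez] : [/\ betahat g (fII_fun b (e_plus K)) = fII_fun b (Ad (val g) (e_plus K)),
    betahat g (fII_fun b (e_minus K)) = fII_fun b (Ad (val g) (e_minus K)) &
    betahat g (fII_fun b (e_zero K)) = fII_fun b (Ad (val g) (e_zero K))].
  rewrite [x]sl2_decomp (decomp _ (Ad (val g)) (lieaut_linear _)).
  rewrite !(decomp _ (fII_fun b) (fII_linear b)).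
  rewrite (linear_comb3 (f := betahat g)) // Ep Em Ez.
  by rewrite fII_linear_comb.
have fZ a (y : sl2 K) : fII_fun b (a *: y) = a *: fII_fun b y :=
  GRing.scalable_linear (fII_linear b) a y.
have fB := GRing.zmod_morphism_linear (fII_linear b).
have fD (y z : sl2 K) : fII_fun b (y + z) = fII_fun b y + fII_fun b z.
  by rewrite -[y in LHS]scale1r fII_linear scale1r.
have aZ a (y : weyl K) : betahat g (a *: y) = a *: betahat g y :=
  GRing.scalable_linear la a y.
have aB := GRing.zmod_morphism_linear la.
have aD (y z : weyl K) : betahat g (y + z) = betahat g y + betahat g z.
  by rewrite -[y in LHS]scale1r la scale1r.
have [-> -> ->] := Bhat_Ad g.
rewrite !fB fD !fZ !(fII_e_plus, fII_e_minus, fII_e_zero).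
have bp : betahat g p = (bscale g)^-1 *: p := betahat_p g.
have bq : betahat g q = bscale g *: (q - (bshift g)%:A) := betahat_q g.
move: (bscale_neq0 g) bp bq; move: (bscale g) (bshift g) => s n s_neq0 bp bq.
have bC : betahat g b%:A = b%:A by rewrite aZ a1.
have bpq : betahat g (p * q) = p * q - n *: p.
  rewrite aM bp bq -scalerAl -scalerAr scalerA mulVf // scale1r mulrBr.
  by rewrite mulr_algr.
have bN : betahat g (- p) = - (s^-1 *: p).
  have b0 : betahat g 0 = 0 by have := aB 0 0; rewrite !subrr.
  by rewrite -[- p]add0r aB b0 bp add0r.
split; last 1 first.
- rewrite aD bC [p * q *+ 2]mulr2n aD bpq scalerN mulr2n scalerDl.
  by rewrite [X in X + _ = _]addrACA -opprD [LHS]addrAC.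
- rewrite aM aD bC bpq bq -scalerAr addrA; set X := b%:A + p * q.
  have -> : p * q *+ 2 + b%:A = X + p * q by rewrite mulr2n addrC addrA.
  rewrite scalerN opprK -!scalerA -!scalerBr -scalerDr; congr (_ *: _); move: X => X.
  rewrite mulrBl !mulrBr !mulr_algr -!scalerAl opprB scalerDr opprD.
  by rewrite [n *: (n *: p) - _]addrC !addrA.
- by rewrite bN scalerN.
Qed.

Lemma isotropyP (s : algaut (weyl K) * lieaut K) :
  isotropy (fII b) s <-> forall x, s.1 (fII_fun b x) = fII_fun b (s.2 x).
Proof.
case: s => f w /=; have wK x : (w^-1)%g (w x) = x by exact: (@sym_funK _ w).
have wVK x : w ((w^-1)%g x) = x by exact: (@sym_invK _ w).
split=> [/(congr1 val)/= E x|E]; last apply: val_inj => /=.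
  have := congr1 (@^~ (w x)) E; rewrite /act_fun /= => <-.
  by congr (f (fII_fun b _)); exact/esym/wK.
by apply/funext => x; rewrite /act_fun /= E; congr (fII_fun b _); exact: wVK.
Qed.

Lemma isotropy_beta (w : Bsl2 K) : isotropy (fII b) (beta w, val w).
Proof. by apply/isotropyP => x; rewrite [LHS]betahat_fII Bhat_ofP. Qed.

(** The flag of [e_-] inside the span of [e_-] and [e_0] is preserved: [lieb] of
    [f (- p) = fII b (w e_-)] is locally nilpotent, being the transport by [f] of
    [lieb (- p)]. *)
Lemma isotropy_flag (s : algaut (weyl K) * lieaut K) : isotropy (fII b) s ->
  exists r n, [/\ r != 0, s.2 (e_minus K) = r *: e_minus K
    & s.2 (e_zero K) = e_zero K + (n *+ 2) *: e_minus K].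
Proof.
case: s => f w /isotropyP /= fw.
have [lf [f1 fM]] := (algaut_linear f, algaut_monoid f).
have fB : Algebra.zmod_morphism f := GRing.zmod_morphism_linear lf.
have f0 : f 0 = 0 by have := fB 0 0; rewrite !subrr.
have fVK u : f (sym_inv f u) = u by exact: sym_invK.
have nil u : ad_nil (fII_fun b (w (e_minus K))) u.
  have pn : ad_nil (- p) (sym_inv f u).
    have [k pk] := ad_p_nil (sym_inv f u); exists k.
    have : iter k (lieb (- p)) (sym_inv f u) = (-1) ^+ k *: iter k (lieb p) (sym_inv f u).
      elim: (k) => [|m IHm]; first by rewrite scale1r.
      rewrite !iterS IHm liebZr exprSr -scalerA; congr (_ *: _).
      by rewrite /lieb mulNr mulrN opprK scaleN1r opprB addrC.
    by rewrite pk scaler0.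
  have [k pk] := pn; exists k; rewrite -fw fII_e_minus -[u in LHS]fVK.
  have -> m v : iter m (lieb (f (- p))) (f v) = f (iter m (lieb (- p)) v).
    by elim: m => //= m ->; rewrite /lieb fB !fM.
  by rewrite pk f0.
have [m00 m01] := ad_nil_fII nil.
have em : w (e_minus K) = w (e_minus K) 1 0 *: e_minus K.
  by apply: sl2P; rewrite ?m00 ?m01 !mxE /= ?mulr0 ?mulr1.
set r : K := w (e_minus K) 1 0 in em.
have r0 : r != 0.
  apply/eqP => r0; have: w (e_minus K) = w 0.
    rewrite em r0 scale0r; have lw := GRing.zmod_morphism_linear (lieaut_linear w).
    by have := lw 0 0; rewrite !subrr => ->.
  move=> /(can_inj (@sym_funK _ w)) /(congr1 (fun y : sl2 K => y 1 0)).
  by rewrite !mxE /= => /eqP; rewrite oner_eq0.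
(* [[e_-, e_0] = 2 e_-] fixes the coefficients of [e_0] and [e_+] in [w e_0]. *)
have wz : sl2_brk (r *: e_minus K) (w (e_zero K)) = 2%:R *: (r *: e_minus K).
  rewrite -em -lieaut_brk brk_mz.
  exact: (GRing.scalable_linear (lieaut_linear w)).
exists r, (w (e_zero K) 1 0 / 2%:R); split=> //; rewrite -mulr_natr divfK ?pnatr_eq0 //.
have two : 2%:R != 0 :> K by rewrite pnatr_eq0.
have := congr1 (fun y : sl2 K => y 1 0) wz; have := congr1 (fun y : sl2 K => y 0 0) wz.
rewrite !sl2_brkE !mxE /= !sl2_11 => h1 h2; apply: sl2P; rewrite !mxE /=.
- apply: (mulfI r0); apply: (mulfI two).
  have -> : 2%:R * (r * (1 + w (e_zero K) 1 0 * 0)) = 2%:R * (r * 1) by ring.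
  by rewrite -[RHS]h2; ring.
- apply: (mulfI r0); apply: oppr_inj.
  have -> : - (r * (0 + w (e_zero K) 1 0 * 0)) = 2%:R * (r * 0) by ring.
  by rewrite -[RHS]h1; ring.
- by ring.
Qed.

(** The values of [f] on the image of [fII b] give [f p] and [f (p * q)], hence
    [f q] by cancelling [p]. *)
Lemma isotropy_inj (f f' : algaut (weyl K)) w :
  isotropy (fII b) (f, w) -> isotropy (fII b) (f', w) -> f = f'.
Proof.
move=> /isotropyP /= fw /isotropyP /= f'w.
have ff' x : f (fII_fun b x) = f' (fII_fun b x) by rewrite fw f'w.
have [[f1 fM] [f'1 f'M]] := (algaut_monoid f, algaut_monoid f').
have fB : Algebra.zmod_morphism f := GRing.zmod_morphism_linear (algaut_linear f).
have f'B : Algebra.zmod_morphism f' := GRing.zmod_morphism_linear (algaut_linear f').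
have fZ a u : f (a *: u) = a *: f u := GRing.scalable_linear (algaut_linear f) a u.
have f'Z a u : f' (a *: u) = a *: f' u := GRing.scalable_linear (algaut_linear f') a u.
have f0 : f 0 = 0 by have := fB 0 0; rewrite !subrr.
have f'0 : f' 0 = 0 by have := f'B 0 0; rewrite !subrr.
have fp : f p = f' p.
  have := ff' (e_minus K); rewrite fII_e_minus -[- p]add0r fB f'B f0 f'0 !add0r.
  exact: oppr_inj.
apply: algaut_ext => //.
have fpq : f (p * q) = f' (p * q).
  (* [p * q] is in the span of [1] and [fII b e_0 = 2 p q + b]. *)
  have pqE : p * q = 2%:R^-1 *: (fII_fun b (e_zero K) - b%:A).
    by rewrite fII_e_zero addrK -scaler_nat scalerA mulVf ?scale1r ?pnatr_eq0.
  by rewrite pqE fZ f'Z fB f'B ff' fZ f'Z f1 f'1.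
have [fVK fI] : (forall u, f (sym_inv f u) = u) /\ injective f.
  by split=> [u|]; [exact: sym_invK | exact: can_inj (@sym_funK _ f)].
have : p * (q - sym_inv f (f' q)) = 0.
  by rewrite mulrBr; apply/eqP; rewrite subr_eq0; apply/eqP/fI; rewrite fpq !fM f'M fVK fp.
by move/weyl_p_lreg/eqP; rewrite subr_eq0 => /eqP qE; rewrite [in LHS]qE fVK.
Qed.

End Intertwining.

(** The square root of [r^-1] provides the entry [a_1]: the action on [e_-] is by
    [a_1 ^- 2]. *)
Lemma isotropy_fII (K : numClosedFieldType) (b : K) :
  isotropy (fII b) = [set (beta w, val w) | w in [set: Bsl2 K]].
Proof.
apply/seteqP; split=> [[f w] fw|_ [w _ <-]]; last exact: isotropy_beta.
have [r [n [r0 wm wz]]] := isotropy_flag fw.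
have [g [sg ng]] : exists g : Bhat K, bscale g = r^-1 /\ bshift g = n.
  by apply: (@Bhat_of_params _ _ _ (sqrtC r^-1)); rewrite ?sqrtCK // sqrtC_eq0 invr_eq0.
have [gm gz _] := Bhat_Ad g.
have wg : w = Ad (val g).
  by apply: lieaut_ext; rewrite ?pnatr_eq0 //= ?wm ?wz [RHS](gm, gz) ?sg ?ng ?invrK.
have Bw : Bsl2 K w by exists (val g) => //; exact: set_mem (valP g).
pose w' : Bsl2 K := exist (fun v => v \in Bsl2 K) w (mem_set Bw).
exists w' => //; congr (_, _).
exact: isotropy_inj (isotropy_beta b w') fw.
Qed.

(** * Matrices of size 3 given by their entries *)

Section Matrices33.
Variable K : comNzRingType.

(** Products, transposes and determinants of matrices of this form are again
    explicit, so that matrix identities reduce to [ring] and [field]. *)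
Definition mx33 (a b c d e f g h k : K) : 'M[K]_3 :=
  \matrix_(i, j) (nth [::] [:: [:: a; b; c]; [:: d; e; f]; [:: g; h; k]] i)`_j.

Lemma ord3P (i : 'I_3) : [\/ i = 0, i = 1 | i = 2%:R].
Proof.
by case: i => -[|[|[|//]]] ?; [constructor 1|constructor 2|constructor 3]; apply: val_inj.
Qed.

Lemma mx33_eta (M : 'M[K]_3) : M = mx33 (M 0 0) (M 0 1) (M 0 2%:R)
  (M 1 0) (M 1 1) (M 1 2%:R) (M 2%:R 0) (M 2%:R 1) (M 2%:R 2%:R).
Proof.
by apply/matrixP => i j; case: (ord3P i) => ->; case: (ord3P j) => ->; rewrite mxE.
Qed.

Lemma mul33 a b c d e f g h k a' b' c' d' e' f' g' h' k' :
  mx33 a b c d e f g h k *m mx33 a' b' c' d' e' f' g' h' k' =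
  mx33 (a * a' + b * d' + c * g') (a * b' + b * e' + c * h') (a * c' + b * f' + c * k')
       (d * a' + e * d' + f * g') (d * b' + e * e' + f * h') (d * c' + e * f' + f * k')
       (g * a' + h * d' + k * g') (g * b' + h * e' + k * h') (g * c' + h * f' + k * k').
Proof.
apply/matrixP => i j; case: (ord3P i) => ->; case: (ord3P j) => ->;
  by rewrite !mxE !big_ord_recl big_ord0 !mxE /= addr0 addrA.
Qed.

Lemma tr33 a b c d e f g h k :
  (mx33 a b c d e f g h k)^T = mx33 a d g b e h c f k.
Proof.
by apply/matrixP => i j; case: (ord3P i) => ->; case: (ord3P j) => ->; rewrite !mxE.
Qed.

Lemma id33 : 1%:M = mx33 1 0 0 0 1 0 0 0 1.
Proof.
by apply/matrixP => i j; case: (ord3P i) => ->; case: (ord3P j) => ->; rewrite !mxE.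
Qed.

Lemma det33 a b c d e f g h k : \det (mx33 a b c d e f g h k) =
  a * (e * k - f * h) - b * (d * k - f * g) + c * (d * h - e * g).
Proof.
rewrite (expand_det_row _ (0 : 'I_3)) !big_ord_recl big_ord0 /cofactor.
rewrite !(expand_det_row _ (0 : 'I_2)) !big_ord_recl !big_ord0 /cofactor !det_mx11 !mxE /=.
by rewrite /bump /=; ring.
Qed.

Lemma mx33_inj a b c d e f g h k a' b' c' d' e' f' g' h' k' :
  mx33 a b c d e f g h k = mx33 a' b' c' d' e' f' g' h' k' ->
  [/\ a = a', b = b' & c = c'] /\ [/\ d = d', e = e' & f = f'] /\
  [/\ g = g', h = h' & k = k'].
Proof.
move=> /matrixP E; have {}E (i j : nat) (Hi : (i < 3)%N) (Hj : (j < 3)%N) :=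
  E (Ordinal Hi) (Ordinal Hj).
by split; [|split]; split;
  [have := E 0%N 0%N isT isT | have := E 0%N 1%N isT isT | have := E 0%N 2%N isT isT
  |have := E 1%N 0%N isT isT | have := E 1%N 1%N isT isT | have := E 1%N 2%N isT isT
  |have := E 2%N 0%N isT isT | have := E 2%N 1%N isT isT | have := E 2%N 2%N isT isT];
  rewrite !mxE.
Qed.

End Matrices33.

(** * SO(3) in an isotropic basis *)

Section IsotropicFrame.
Variable K : numClosedFieldType.
Implicit Types (g : SO3 K) (M : 'M[K]_3) (s n : K).

(** The columns are the coordinates of [e_-], [e_0], [e_+] in the basis [e_0],
    [e_+ + e_-], ['i (e_+ - e_-)] of sl(2), which is orthonormal for half of the
    trace form. *)
Definition frame : 'M[K]_3 :=
  mx33 0 1 0 (2%:R^-1) 0 (2%:R^-1) ('i / 2%:R) 0 (- ('i / 2%:R)).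

Definition coframe : 'M[K]_3 := mx33 0 1 (- 'i) 1 0 0 0 1 'i.

(** The Gram matrix of the trace form [tr (x y)] on [e_-], [e_0], [e_+]. *)
Definition killing : 'M[K]_3 := mx33 0 0 1 0 2%:R 0 1 0 0.

Lemma coframeK : coframe *m frame = 1%:M.
Proof.
have i2E : ('i * 'i : K) = -1 by rewrite -expr2 sqrCi.
by rewrite mul33 id33; congr mx33; rewrite ?mulrN ?mulNr ?mulrA ?i2E; field.
Qed.

Lemma frameK : frame *m coframe = 1%:M. Proof. exact: mulmx1C coframeK. Qed.

Lemma frame_form : frame^T *m frame = 2%:R^-1 *: killing.
Proof.
have i2E : ('i * 'i : K) = -1 by rewrite -expr2 sqrCi.
have -> : 2%:R^-1 *: killing = mx33 0 0 2%:R^-1 0 1 0 2%:R^-1 0 0.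
  by apply/matrixP => i j; case: (ord3P i) => ->; case: (ord3P j) => ->;
    rewrite !mxE /=; field.
have iE : 'i / 2%:R * ('i / 2%:R) = - (2%:R^-1 * 2%:R^-1) :> K.
  by rewrite mulrACA i2E mulN1r.
by rewrite tr33 mul33; congr mx33; rewrite ?mulrN ?mulNr ?iE; field.
Qed.

Definition in_frame M : 'M[K]_3 := coframe *m M *m frame.

Lemma in_frameM M N : in_frame (M *m N) = in_frame M *m in_frame N.
Proof.
by rewrite /in_frame !mulmxA -[_ *m frame *m coframe]mulmxA frameK mulmx1.
Qed.

Lemma in_frameK M : frame *m in_frame M *m coframe = M.
Proof.
by rewrite /in_frame !mulmxA frameK mul1mx -mulmxA frameK mulmx1.
Qed.

Lemma in_frameVK M : in_frame (frame *m M *m coframe) = M.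
Proof.
by rewrite /in_frame !mulmxA coframeK mul1mx -mulmxA coframeK mulmx1.
Qed.

Lemma in_frame_form g : (in_frame g)^T *m killing *m in_frame g = killing.
Proof.
have two : 2%:R != 0 :> K by rewrite pnatr_eq0.
have kE : killing = 2%:R *: (frame^T *m frame) by rewrite frame_form scalerA divff ?scale1r.
have fcK : frame *m in_frame g = g *m frame.
  by rewrite /in_frame !mulmxA frameK mul1mx.
rewrite kE -scalemxAr -scalemxAl; congr (_ *: _).
move: (in_frame g) fcK => X fcK.
rewrite mulmxA -trmx_mul -[LHS]mulmxA fcK trmx_mul mulmxA -[_ *m g^T *m g]mulmxA.
by rewrite (mulmx1C (SO3V g)) mulmx1.
Qed.

Lemma det_in_frame M : \det (in_frame M) = \det M.
Proof.
by rewrite /in_frame !det_mulmx mulrAC -det_mulmx coframeK det1 mul1r.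
Qed.

Lemma SO3_of_frame M : M^T *m killing *m M = killing -> \det M = 1 ->
  exists g : SO3 K, in_frame g = M.
Proof.
move=> MJ M1; set g := frame *m M *m coframe.
have two : 2%:R != 0 :> K by rewrite pnatr_eq0.
have kE : killing = 2%:R *: (frame^T *m frame) by rewrite frame_form scalerA divff ?scale1r.
have MC : M^T *m (frame^T *m frame) *m M = frame^T *m frame.
  by apply: (scalerI two); move: MJ; rewrite kE -scalemxAr -scalemxAl.
have gg : g^T *m g = 1%:M.
  rewrite /g !trmx_mul -!mulmxA [frame^T *m (frame *m _)]mulmxA.
  rewrite [M^T *m _]mulmxA [M^T *m _ *m _]mulmxA MC -mulmxA frameK mulmx1.
  by rewrite -trmx_mul frameK trmx1.
have g1 : \det g = 1 by rewrite -M1 -[in RHS](in_frameVK M) det_in_frame.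
have Pg : (g *m g^T == 1%:M) && (\det g == 1) by rewrite (mulmx1C gg) g1 !eqxx.
by exists (SO3_of Pg); rewrite /= in_frameVK.
Qed.

Lemma in_frame_inj g g' : in_frame g = in_frame g' -> g = g'.
Proof. by move=> E; apply: val_inj; rewrite /= -[LHS]in_frameK E in_frameK. Qed.

(** The matrix of [Ad g] in the basis [e_-], [e_0], [e_+], where [bscale g = s]
    and [bshift g = n]; see [lieaut_mx_Ad]. *)
Definition borel_mx s n : 'M[K]_3 :=
  mx33 s^-1 (n *+ 2) (- (s * n ^+ 2)) 0 1 (- (s * n)) 0 0 s.

Lemma borel_mxM s n s' n' : s != 0 -> s' != 0 ->
  borel_mx s n *m borel_mx s' n' = borel_mx (s * s') (n + n' / s).
Proof. by move=> s0 s'0; rewrite mul33; congr mx33; field; rewrite ?s0 ?s'0. Qed.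

(** The value is meaningful for [s != 0] only; the default [SO3_one] avoids a
    dependency on a proof of that. *)
Definition borel_elt s n : SO3 K :=
  insubd (SO3_one K) (frame *m borel_mx s n *m coframe).

Lemma in_frame_borel s n : s != 0 -> in_frame (borel_elt s n) = borel_mx s n.
Proof.
move=> s0; have [g gE] : exists g : SO3 K, in_frame g = borel_mx s n.
  apply: SO3_of_frame; first by rewrite tr33 !mul33; congr mx33; field.
  by rewrite det33; field.
by rewrite /borel_elt -gE in_frameK valKd.
Qed.

Lemma borel_eltM s n s' n' : s != 0 -> s' != 0 ->
  (borel_elt s n * borel_elt s' n')%g = borel_elt (s * s') (n + n' / s).
Proof.
move=> s0 s'0; apply: in_frame_inj.
by rewrite [LHS]in_frameM !in_frame_borel ?borel_mxM // mulf_neq0.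
Qed.

Lemma borel_elt1 : borel_elt 1 0 = 1%g.
Proof.
apply: in_frame_inj; rewrite in_frame_borel ?oner_neq0 //.
rewrite [RHS](_ : _ = 1%:M); last by rewrite /in_frame mulmx1 coframeK.
by rewrite id33; congr mx33; rewrite ?invr1 //; ring.
Qed.

Lemma borel_eltV s n : s != 0 -> (borel_elt s n)^-1%g = borel_elt s^-1 (- (s * n)).
Proof.
move=> s0; apply: (@mulgI _ (borel_elt s n)); rewrite mulgV borel_eltM ?invr_eq0 //.
by rewrite divff // -borel_elt1; congr borel_elt; field.
Qed.

Lemma borel_elt_inj s n s' n' : s != 0 -> s' != 0 ->
  borel_elt s n = borel_elt s' n' -> s = s' /\ n = n'.
Proof.
move=> s0 s'0 /(congr1 (fun g : SO3 K => in_frame g)); rewrite !in_frame_borel //.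
move=> /mx33_inj [[_ n2 _] [_ [_ _ ->]]]; split=> //.
by apply: (@mulIf _ 2%:R); rewrite ?pnatr_eq0 // !mulr_natr.
Qed.

(** The stabiliser of the isotropic line spanned by the first vector of the
    frame, which stands for [e_-]. *)
Definition line_stab : set (SO3 K) :=
  [set g | in_frame g 1 0 = 0 /\ in_frame g 2%:R 0 = 0].

Lemma borel_elt_stab s n : s != 0 -> line_stab (borel_elt s n).
Proof. by move=> s0; rewrite /line_stab /= in_frame_borel // !mxE. Qed.

(** A matrix preserving the form and its first basis line preserves the whole
    flag, so it is upper triangular; the diagonal is [1/l], [z], [l] with
    [z^2 = 1], and the determinant excludes [z = -1].  Since the last column is
    isotropic and orthogonal to the middle one, [l] and [t] determine the two
    remaining entries. *)
Lemma line_stabP g : line_stab g -> exists s n, s != 0 /\ g = borel_elt s n.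
Proof.
case=> g10 g20; have J := in_frame_form g; have := det_in_frame g; rewrite SO3_det.
move: J; have := mx33_eta (in_frame g); rewrite g10 g20.
move: (in_frame g 0 0) (in_frame g 0 1) (in_frame g 0 2%:R) (in_frame g 1 1)
  (in_frame g 1 2%:R) (in_frame g 2%:R 1) (in_frame g 2%:R 2%:R) => r x y z t k l gE.
rewrite gE tr33 /killing !mul33 det33 => /mx33_inj[[_ e01 e02] [[_ _ e12] [_ _ e22]]] d.
have two : 2%:R != 0 :> K by rewrite pnatr_eq0.
have rl : r * l = 1 by rewrite -[RHS]e02; ring.
have r0 : r != 0 by apply: contra_eq_neq rl => ->; rewrite mul0r eq_sym oner_neq0.
have l0 : l != 0 by apply: contra_eq_neq rl => ->; rewrite mulr0 eq_sym oner_neq0.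
have k0 : k = 0 by apply: (mulfI r0); rewrite mulr0 -[RHS]e01; ring.
have z1 : z = 1.
  transitivity (r * l * z); first by rewrite rl mul1r.
  by rewrite -[RHS]d k0; ring.
have {}rl : r = l^-1 by apply: (mulIf l0); rewrite rl mulVf.
exists l, (- (t / l)); split=> //; apply: in_frame_inj; rewrite in_frame_borel //.
rewrite gE rl k0 z1.
have xl : x = (- (t / l)) *+ 2.
  apply: (mulIf l0); have -> : (- (t / l)) *+ 2 * l = - (2%:R * t) by field.
  apply/eqP; rewrite -subr_eq0 opprK -[X in _ == X]e12 k0 z1.
  by apply/eqP; ring.
have yl : y = - (l * (- (t / l)) ^+ 2).
  apply: (mulIf l0); apply: (mulfI two).
  have -> : 2%:R * (- (l * (- (t / l)) ^+ 2) * l) = - (2%:R * t ^+ 2) by field.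
  by apply/eqP; rewrite -subr_eq0 opprK -[X in _ == X]e22; apply/eqP; ring.
by congr mx33 => //; field.
Qed.

End IsotropicFrame.

(** * Derived subgroups *)

Section Subgroups.
Variable G : groupType.
Implicit Types (H L : set G) (x y : G).
Local Open Scope group_scope.

Lemma is_subgroupP H : is_subgroup H <->
  [/\ H 1, forall x y, H x -> H y -> H (x * y) & forall x, H x -> H x^-1].
Proof.
split=> [[/set_mem H1 HD]|[H1 HM HV]].
  have HV x : H x -> H x^-1.
    by move=> Hx; rewrite -[x^-1]mul1g; apply/set_mem/HD; apply/mem_set.
  split=> // x y Hx /HV Hy.
  by rewrite -[y]invgK; apply/set_mem/HD; apply/mem_set.
split; first exact/mem_set.
by move=> x y /set_mem Hx /set_mem Hy; apply/mem_set/HM => //; exact: HV.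
Qed.

Lemma is_subgroup1 : is_subgroup [set 1 : G].
Proof.
by apply/is_subgroupP; split=> // [x y /= -> ->|x /= ->]; rewrite ?mulg1 ?invg1.
Qed.

Lemma derived_sub_min H L : is_subgroup L ->
  (forall x y, H x -> H y -> L [~ x, y]) -> derived_sub H `<=` L.
Proof.
by move=> sL cL g; apply; split=> // _ [x Hx [y Hy <-]]; exact: cL.
Qed.

Lemma derived_sub_comm H x y : H x -> H y -> derived_sub H [~ x, y].
Proof. by move=> Hx Hy L [_]; apply; exists x => //; exists y. Qed.

Lemma derived_sub_subgroup H : is_subgroup (derived_sub H).
Proof.
apply/is_subgroupP; split=> [L [/is_subgroupP[]] //|x y Dx Dy L sL|x Dx L sL].
  have [/is_subgroupP[_ LM _] _] := sL.
  by apply: LM; [exact: Dx|exact: Dy].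
by have [/is_subgroupP[_ _ LV] _] := sL; exact: LV _ (Dx L sL).
Qed.

Lemma iter_derived_subgroup H n : is_subgroup H -> is_subgroup (iter n (@derived_sub G) H).
Proof. by case: n => //= n _; exact: derived_sub_subgroup. Qed.

End Subgroups.

(** * The stabiliser of an isotropic line is a maximal solvable subgroup *)

Section BorelSubgroup.
Variable K : numClosedFieldType.
Implicit Types (g : SO3 K) (s n : K) (G : set (SO3 K)).
Local Notation line_stab := (@line_stab K).
Local Open Scope group_scope.

Lemma line_stab_subgroup : is_subgroup line_stab.
Proof.
apply/is_subgroupP; split.
- by rewrite -borel_elt1; apply: borel_elt_stab; exact: oner_neq0.
- move=> _ _ /line_stabP[s [n [s0 ->]]] /line_stabP[s' [n' [s'0 ->]]].
  by rewrite borel_eltM //; apply: borel_elt_stab; rewrite mulf_neq0.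
- move=> _ /line_stabP[s [n [s0 ->]]].
  by rewrite borel_eltV //; apply: borel_elt_stab; rewrite invr_eq0.
Qed.

Definition unipotent : set (SO3 K) := [set borel_elt 1 n | n in [set: K]].

Lemma unipotentM n n' : borel_elt 1 n * borel_elt 1 n' = borel_elt 1 (n + n')%R.
Proof. by rewrite borel_eltM ?oner_neq0 // mulr1 divr1. Qed.

Lemma unipotentV n : (borel_elt 1 n)^-1 = borel_elt 1 (- n)%R.
Proof. by rewrite borel_eltV ?oner_neq0 // invr1 mul1r. Qed.

Lemma unipotent_subgroup : is_subgroup unipotent.
Proof.
apply/is_subgroupP; split.
- by exists 0%R => //; exact: borel_elt1.
- by move=> _ _ [n _ <-] [n' _ <-]; rewrite unipotentM; exists (n + n')%R.
- by move=> _ [n _ <-]; rewrite unipotentV; exists (- n)%R.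
Qed.

Lemma borel_comm s n s' n' : s != 0%R -> s' != 0%R ->
  [~ borel_elt s n, borel_elt s' n'] =
  borel_elt 1 (- (s * n) - s * (s' * n') + s * s' * n + s' * n')%R.
Proof.
move=> s0 s'0; apply: (@mulgI _ (borel_elt s' n' * borel_elt s n)).
rewrite -commgC !borel_eltM ?mulf_neq0 ?oner_neq0 // mulr1 [(s' * s)%R]mulrC.
by congr borel_elt; field; rewrite ?s0 ?s'0.
Qed.

Lemma line_stab_solvable : solvable_sub line_stab.
Proof.
have D1 : derived_sub line_stab `<=` unipotent.
  apply: derived_sub_min unipotent_subgroup _.
  move=> _ _ /line_stabP[s [n [s0 ->]]] /line_stabP[s' [n' [s'0 ->]]].
  by rewrite borel_comm //; eexists.
exists 2%N; apply/seteqP; split=> /=.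
  apply: derived_sub_min (is_subgroup1 _) _.
  move=> _ _ /D1[n _ <-] /D1[n' _ <-] /=.
  rewrite borel_comm ?oner_neq0 // -borel_elt1; congr borel_elt.
  by rewrite !mul1r; ring.
move=> _ ->; have /is_subgroupP[] := derived_sub_subgroup (derived_sub line_stab).
by [].
Qed.

(** The rotation exchanging the isotropic lines of [e_-] and [e_+]: it represents
    the nontrivial element of the Weyl group. *)
Lemma flip_elt_subproof : exists g : SO3 K,
  in_frame g = mx33 0 0 (-1) 0 (-1) 0 (-1) 0 0.
Proof.
apply: SO3_of_frame; first by rewrite tr33 !mul33; congr mx33; ring.
by rewrite det33; ring.
Qed.

Definition flip_elt : SO3 K := sval (cid flip_elt_subproof).

Lemma in_frame_flip : in_frame flip_elt = mx33 0 0 (-1) 0 (-1) 0 (-1) 0 0.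
Proof. exact: svalP (cid flip_elt_subproof). Qed.

Lemma in_frame_mul g g' : in_frame (g * g')%g = in_frame g *m in_frame g'.
Proof. exact: in_frameM. Qed.

Lemma flip_eltV : flip_elt^-1 = flip_elt.
Proof.
apply: (@mulgI _ flip_elt); rewrite mulgV -borel_elt1; apply: in_frame_inj.
rewrite in_frame_mul in_frame_flip in_frame_borel ?oner_neq0 // mul33.
by congr mx33; rewrite ?invr1; ring.
Qed.

(** The image in SO(3) of the factorisation of the Weyl element of SL(2) as
    [x(1) y(-1) x(1)], with [x] and [y] the two families of elementary matrices. *)
Lemma flip_unipotent : borel_elt 1 1 * (flip_elt * borel_elt 1 1 * flip_elt) * borel_elt 1 1
  = flip_elt.
Proof.
apply: in_frame_inj; rewrite !in_frame_mul in_frame_flip in_frame_borel ?oner_neq0 //.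
by rewrite !mul33; congr mx33; rewrite ?invr1; ring.
Qed.

(** In SL(2), [x(a) y(-1/a) x(a)] times the Weyl element is diagonal.  One torus
    element other than 1 is enough below, so [a = 2] is taken, which gives
    [s = a^-2 = 1/4]. *)
Lemma torus_unipotent : borel_elt 1 2%:R *
    (flip_elt * borel_elt 1 (2%:R^-1)%R * flip_elt) * borel_elt 1 2%:R * flip_elt =
  borel_elt (4%:R^-1)%R 0.
Proof.
have four : (4%:R^-1)%R != 0%R :> K by rewrite invr_eq0 pnatr_eq0.
apply: in_frame_inj; rewrite !in_frame_mul in_frame_flip !in_frame_borel ?oner_neq0 //.
by rewrite !mul33; congr mx33; rewrite ?invr1 ?invrK; field.
Qed.

(** [G] contains the unipotent subgroups fixing the isotropic vectors [e_-]
    and [e_+]. *)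
Definition opposite_unipotents G :=
  (forall n, G (borel_elt 1 n)) /\ (forall n, G (borel_elt 1 n ^ flip_elt)).

Lemma conj_flip g : g ^ flip_elt = flip_elt * g * flip_elt.
Proof. by rewrite /conjg flip_eltV mulgA. Qed.

Lemma opposite_unipotents_flip G : is_subgroup G -> opposite_unipotents G -> G flip_elt.
Proof.
move=> /is_subgroupP[_ GM _] [Gm Gp]; rewrite -flip_unipotent -conj_flip.
by apply/GM/Gm/GM/Gp/Gm.
Qed.

(** The torus element [t] with [s = 1/4] acts on the unipotent subgroup by a
    nontrivial scaling, so [[t, u]] runs through all of that subgroup: its
    parameter is [1 - s = 3/4] times that of [u].  Conjugation by the flip gives
    the opposite one. *)
Lemma derived_unipotents G : is_subgroup G -> opposite_unipotents G ->
  opposite_unipotents (derived_sub G).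
Proof.
move=> sG pG; have Gw := opposite_unipotents_flip sG pG.
have [_ GM GV] := (is_subgroupP G).1 sG; have [Gm Gp] := pG.
have Gt : G (borel_elt (4%:R^-1)%R 0).
  by rewrite -torus_unipotent -conj_flip; apply/GM/Gw/GM/Gm/GM/Gp/Gm.
have four : (4%:R^-1)%R != 0%R :> K by rewrite invr_eq0 pnatr_eq0.
have E n : borel_elt 1 n = [~ borel_elt (4%:R^-1)%R 0, borel_elt 1 (n * 4%:R / 3%:R)%R].
  by rewrite borel_comm ?oner_neq0 //; congr borel_elt; field.
split=> n; rewrite E; first exact: derived_sub_comm.
by rewrite conjRg; apply: derived_sub_comm => //; rewrite conj_flip; apply/GM/Gw/GM.
Qed.

Lemma opposite_unipotents_unsolvable G : is_subgroup G -> opposite_unipotents G ->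
  ~ solvable_sub G.
Proof.
move=> sG pG [n]; have : opposite_unipotents (iter n (@derived_sub (SO3 K)) G).
  by elim: n => //= n IHn; apply: derived_unipotents (iter_derived_subgroup _ sG) IHn.
move=> [/(_ 1%R) + _] E; rewrite E /= -borel_elt1 => /borel_elt_inj[] //.
- exact: oner_neq0.
- exact: oner_neq0.
- by move=> _ /eqP; rewrite oner_eq0.
Qed.

(** The first column of [in_frame g] is isotropic, like [e_-]. *)
Lemma isotropic_column g :
  (in_frame g 0 0 * in_frame g 2%:R 0 + in_frame g 1 0 ^+ 2 = 0)%R.
Proof.
have := in_frame_form g; rewrite {1 2}[in_frame g]mx33_eta tr33 /killing !mul33.
move=> /mx33_inj[[E _ _] _].
by apply: (@mulfI _ 2%:R); rewrite ?pnatr_eq0 // mulr0 -[RHS]E; ring.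
Qed.

(** Bruhat decomposition: the unipotent subgroup acts transitively on the
    isotropic lines other than that of [e_-].  So some unipotent [h] moves the
    line [g e_-] to the line of [e_+], the flip moves it back to that of [e_-],
    and therefore [flip_elt * h * g] is in [line_stab]. *)
Lemma flip_elt_mem G g : is_subgroup G -> line_stab `<=` G -> G g ->
  ~ line_stab g -> G flip_elt.
Proof.
move=> /is_subgroupP[G1 GM GV] sG Gg nsg.
have := isotropic_column g.
set x := in_frame g 0 0; set z := in_frame g 1%R 0; set y := in_frame g 2%:R 0 => xyz.
have y0 : y != 0%R.
  apply/eqP => y0; apply: nsg; split=> //; apply/eqP.
  by move/eqP: xyz; rewrite y0 mulr0 add0r expf_eq0.
pose h := borel_elt 1 (z / y)%R.
have Gh : G h by apply/sG/borel_elt_stab/oner_neq0.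
have sk : line_stab (flip_elt * h * g).
  have xE : x = (- (z ^+ 2 / y))%R.
    by apply: (mulIf y0); rewrite mulNr divfK //; apply/eqP; rewrite -subr_eq0 opprK xyz.
  have : in_frame (flip_elt * h * g)%g =
      in_frame flip_elt *m in_frame h *m in_frame g by rewrite !in_frame_mul.
  rewrite in_frame_flip in_frame_borel ?oner_neq0 //.
  rewrite [in X in _ = X -> _](mx33_eta (in_frame g)) !mul33 -/x -/y -/z xE ?invr1 => kE.
  by split; rewrite kE mxE /=; field.
have -> : flip_elt = flip_elt * h * g * g^-1 * h^-1 by rewrite !mulgK.
by apply/GM/GV/Gh/GM/GV/Gg/sG.
Qed.

Lemma line_stab_maximal G : is_subgroup G -> solvable_sub G ->
  line_stab `<=` G -> G = line_stab.
Proof.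
move=> subG solG sG; apply/seteqP; split=> // g Gg; apply: contrapT => nsg.
have Gw := flip_elt_mem subG sG Gg nsg.
have [_ GM _] := (is_subgroupP G).1 subG.
apply: (opposite_unipotents_unsolvable subG) solG; split=> n.
  by apply/sG/borel_elt_stab/oner_neq0.
by rewrite conj_flip; apply/GM/Gw/GM/sG/borel_elt_stab/oner_neq0.
Qed.

End BorelSubgroup.

(** * Zariski closedness and connectedness *)

Section Zariski.
Variable K : numClosedFieldType.

(** Along a rational curve with denominator [s], a polynomial function becomes a
    polynomial in the parameter after multiplication by a power of [s]. *)
Lemma meval_ratio N (P : {mpoly K[N]}) (E : 'I_N -> {poly K}) (s : {poly K}) :
  exists d (Q : {poly K}), forall t (v : 'I_N -> K), s.[t] != 0 ->
    (forall k, v k * s.[t] = (E k).[t]) ->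
    meval v P * s.[t] ^+ d = Q.[t].
Proof.
elim/mpolyind: P => [|c m P _ _ [d [Q PQ]]].
  by exists 0%N, 0 => t v _ _; rewrite meval0 mul0r horner0.
exists (\sum_(i < N) m i + d)%N,
  (c *: (\prod_(i < N) E i ^+ m i) * s ^+ d + s ^+ (\sum_(i < N) m i) * Q) => t v st vE.
rewrite mevalD mevalZ mevalX hornerD !hornerM hornerZ !horner_exp.
rewrite -(PQ _ _ st vE) horner_prod mulrDl exprD; congr (_ + _); last by rewrite mulrCA.
rewrite mulrA -!mulrA; congr (_ * _); rewrite !mulrA; congr (_ * _).
rewrite expr_sum -big_split /=; apply: eq_bigr => i _.
by rewrite -exprMn vE horner_exp.
Qed.

Lemma line_stab_closed : zariski_closed (@line_stab K).
Proof.
pose X j k : {mpoly K[3 * 3]} := 'X_(mxvec_index j k).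
pose P i := \sum_j \sum_k (coframe K i j * frame K k 0) *: X j k.
have PE i (g : SO3 K) : meval (fun k => mxvec (g : 'M_3) 0 k) (P i) = in_frame g i 0.
  rewrite /in_frame mxE.
  rewrite (eq_bigr (fun k => \sum_j coframe K i j * (g : 'M_3) j k * frame K k 0)); last first.
    by move=> k _; rewrite mxE mulr_suml.
  rewrite exchange_big /P raddf_sum /=; apply: eq_bigr => j _.
  rewrite raddf_sum /=; apply: eq_bigr => k _.
  by rewrite mevalZ mevalXU mxvecE mulrAC.
exists [set P 1; P 2%:R]; apply/seteqP; split=> g /=.
  by move=> [g1 g2] _ [->|->]; rewrite PE.
by move=> gP; split; rewrite -PE; apply: gP; [left|right].
Qed.

(** The curve [t |-> borel_elt (line s1 s2).[t] (line n1 n2).[t]] joins two given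
    points of [line_stab], at the parameters [0] and [1]. *)
Definition line (a b : K) : {poly K} := a%:P + (b - a) *: 'X.

Lemma line0 a b : (line a b).[0] = a.
Proof. by rewrite /line hornerD hornerC hornerZ hornerX mulr0 addr0. Qed.

Lemma line1 a b : (line a b).[1] = b.
Proof. by rewrite /line hornerD hornerC hornerZ hornerX mulr1 addrC subrK. Qed.

(** The entries of [borel_elt s n], cleared of the denominator [s]. *)
Definition borel_poly_mx (s n : {poly K}) : 'M[{poly K}]_3 :=
  map_mx polyC (frame K) *m
  mx33 1 (s * n *+ 2) (- (s * n) ^+ 2) 0 s (- (s ^+ 2 * n)) 0 0 (s ^+ 2) *m
  map_mx polyC (coframe K).

Lemma borel_poly_mxE (s n : {poly K}) t : s.[t] != 0 ->
  map_mx (horner_eval t) (borel_poly_mx s n) =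
  s.[t] *: (borel_elt s.[t] n.[t] : 'M_3).
Proof.
move=> st; rewrite /borel_poly_mx !map_mxM.
have KE (A : 'M[K]_3) : map_mx (horner_eval t) (map_mx polyC A) = A.
  by apply/matrixP => i j; rewrite !mxE /= /horner_eval hornerC.
rewrite !KE -(in_frameK (borel_elt _ _)) in_frame_borel // scalemxAl scalemxAr.
congr (_ *m _ *m _); apply/matrixP => i j.
by case: (ord3P i) => ->; case: (ord3P j) => ->;
  rewrite !mxE /= /horner_eval !(hornerE, hornerMn) /=; field.
Qed.

(** Suppose that two closed sets cover [line_stab], the first missing [g1] and
    the second [g2].  On the curve through [g1] and [g2], one equation of each
    set becomes a nonzero polynomial in the parameter; their product with [s] has
    a parameter where it does not vanish, and the corresponding point of the
    curve is in neither set. *)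
Lemma line_stab_connected : zariski_connected (@line_stab K).
Proof.
move=> _ _ [S1 ->] [S2 ->] cover _.
apply: contrapT => /not_orP[].
move=> /existsNP[g1 /not_implyP[Hg1 /existsNP[P1 /not_implyP[SP1 g1P]]]].
move=> /existsNP[g2 /not_implyP[Hg2 /existsNP[P2 /not_implyP[SP2 g2P]]]].
have [s1 [n1 [s10 g1E]]] := line_stabP Hg1.
have [s2 [n2 [s20 g2E]]] := line_stabP Hg2.
pose s := line s1 s2; pose n := line n1 n2.
pose E (k : 'I_(3 * 3)) : {poly K} := mxvec (borel_poly_mx s n) 0 k.
have gE t k : s.[t] != 0 ->
    mxvec (borel_elt s.[t] n.[t] : 'M_3) 0 k * s.[t] = (E k).[t].
  move=> st; rewrite mulrC.
  have := congr1 (fun M : 'M_3 => mxvec M 0 k) (borel_poly_mxE n st).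
  by rewrite /E; case/mxvec_indexP: k => i j; rewrite !mxvecE !mxE => <-.
have [d1 [Q1 Q1E]] := meval_ratio P1 E s.
have [d2 [Q2 Q2E]] := meval_ratio P2 E s.
have s0 : s.[0] != 0 by rewrite line0.
have s1' : s.[1] != 0 by rewrite line1.
have nonzero (Q : {poly K}) t : Q.[t] != 0 -> Q != 0.
  by apply: contra_neq => ->; rewrite horner0.
have Q10 : Q1 != 0.
  apply: (nonzero _ 0); rewrite -(Q1E _ _ s0 (fun k => gE 0 k s0)) mulf_neq0 ?expf_neq0 //.
  by rewrite !line0 -g1E; apply/eqP.
have Q20 : Q2 != 0.
  apply: (nonzero _ 1); rewrite -(Q2E _ _ s1' (fun k => gE 1 k s1')) mulf_neq0 ?expf_neq0 //.
  by rewrite !line1 -g2E; apply/eqP.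
have /closed_nonrootP[t] : s * Q1 * Q2 != 0.
  by rewrite !mulf_neq0 // (nonzero _ 0).
rewrite /root !hornerM !mulf_eq0 !negb_or => /andP[/andP[st Q1t] Q2t].
case: (cover _ (borel_elt_stab n.[t] st)) => /= [/(_ _ SP1) P0|/(_ _ SP2) P0].
  by move: Q1t; rewrite -(Q1E _ _ st (fun k => gE t k st)) P0 mul0r eqxx.
by move: Q2t; rewrite -(Q2E _ _ st (fun k => gE t k st)) P0 mul0r eqxx.
Qed.

Lemma line_stab_borel : borel (@line_stab K).
Proof.
split; first by split; [exact: line_stab_subgroup|exact: line_stab_closed|
  exact: line_stab_connected|exact: line_stab_solvable].
by move=> G [sG _ _ solG]; exact: line_stab_maximal.
Qed.

End Zariski.

(** * The isotropy group as a Borel subgroup *)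

Section Isomorphism.
Variable K : numClosedFieldType.
Implicit Types (g : Bhat K) (w : lieaut K).

(** The matrix of [w] in the basis [e_-], [e_0], [e_+]: the coordinates of [x] are
    [x 1 0], [x 0 0] and [x 0 1]. *)
Definition lieaut_mx w : 'M[K]_3 :=
  mx33 (w (e_minus K) 1 0) (w (e_zero K) 1 0) (w (e_plus K) 1 0)
       (w (e_minus K) 0 0) (w (e_zero K) 0 0) (w (e_plus K) 0 0)
       (w (e_minus K) 0 1) (w (e_zero K) 0 1) (w (e_plus K) 0 1).

Lemma lieaut_mxM w w' : lieaut_mx (w * w')%g = lieaut_mx w *m lieaut_mx w'.
Proof.
have E x i j : (w * w')%g x i j = w' x 0 1 * w (e_plus K) i j +
    w' x 1 0 * w (e_minus K) i j + w' x 0 0 * w (e_zero K) i j.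
  rewrite [LHS](_ : _ = w (w' x) i j) // {1}[w' x]sl2_decomp.
  by rewrite (linear_comb3 (f := w)) ?mxE //; exact: lieaut_linear.
by rewrite mul33; congr mx33; rewrite E; ring.
Qed.

Lemma lieaut_mx_Ad g : lieaut_mx (Ad (val g)) = borel_mx (bscale g) (bshift g).
Proof.
rewrite /lieaut_mx; have [-> -> ->] := Bhat_Ad g.
by congr mx33; rewrite !mxE /=; ring.
Qed.

(** On pairs outside the isotropy group the matrix need not be orthogonal; the
    default [SO3_one] makes the map total. *)
Definition isotropy_to_SO3 (s : algaut (weyl K) * lieaut K) : SO3 K :=
  insubd (SO3_one K) (frame K *m lieaut_mx s.2 *m coframe K).

Lemma isotropy_to_SO3_Ad f g :
  isotropy_to_SO3 (f, Ad (val g)) = borel_elt (bscale g) (bshift g).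
Proof. by rewrite /isotropy_to_SO3 lieaut_mx_Ad. Qed.

Lemma Ad_inj g g' : bscale g = bscale g' -> bshift g = bshift g' ->
  Ad (val g) = Ad (val g').
Proof.
move=> sE nE; have [gm gz _] := Bhat_Ad g; have [gm' gz' _] := Bhat_Ad g'.
by apply: lieaut_ext; rewrite ?pnatr_eq0 // ?gm ?gm' ?gz ?gz' ?sE ?nE.
Qed.

Lemma isotropy_isog (b : K) : sub_isog (isotropy (fII b)) (@line_stab K).
Proof.
have isoP s : isotropy (fII b) s -> exists f g, s = (f, Ad (val g)).
  rewrite isotropy_fII => -[w _ <-].
  by exists (beta w), (Bhat_of w); rewrite Bhat_ofP.
exists isotropy_to_SO3; split; first split.
- move=> s /isoP[f [g ->]]; rewrite isotropy_to_SO3_Ad.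
  exact/borel_elt_stab/bscale_neq0.
- move=> s s' /set_mem sI /set_mem s'I; have [f [g sE]] := isoP _ sI.
  have [f' [g' s'E]] := isoP _ s'I; move: sI s'I; rewrite sE s'E !isotropy_to_SO3_Ad.
  move=> sI s'I /borel_elt_inj[]; try exact: bscale_neq0.
  move=> /Ad_inj + /[dup] _ nE => /(_ nE) gE.
  by rewrite gE in sI *; rewrite (isotropy_inj sI s'I).
- move=> _ /line_stabP[s [n [s0 ->]]].
  have [g [<- <-]] : exists g : Bhat K, bscale g = s /\ bshift g = n.
    by apply: (@Bhat_of_params _ _ _ (sqrtC s)); rewrite ?sqrtCK // sqrtC_eq0.
  exists (betahat g, Ad (val g)); last exact: isotropy_to_SO3_Ad.
  by apply/isotropyP => x; exact: betahat_fII.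
- move=> _ _ /set_mem/isoP[f [g ->]] /set_mem/isoP[f' [g' ->]].
  rewrite !isotropy_to_SO3_Ad borel_eltM ?bscale_neq0 //.
  rewrite /isotropy_to_SO3 [_.2](_ : _ = (Ad (val g) * Ad (val g'))%g) //.
  by rewrite lieaut_mxM !lieaut_mx_Ad borel_mxM ?bscale_neq0.
Qed.

End Isomorphism.

Local Open Scope complex_scope.

Theorem proposition6p12 (R : realType) (b : R[i]) :
  isotropy (fII b) = [set (beta w, val w) | w in [set: Bsl2 R[i]]] /\
  exists H : set (SO3 R[i]), borel H /\ sub_isog (isotropy (fII b)) H.
Proof.
split; first exact: isotropy_fII.
by exists (@line_stab _); split; [exact: line_stab_borel | exact: isotropy_isog].
Qed.
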